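(* Let $\varphi\in\mathcal{S}_r\cap\mathcal{C}$. Then the set of all jump discontinuities of $\varphi$ in $(0,1)$ equals the disjoint union $$\bigsqcup_{\substack{n\ge3\\ J_\varphi(\frac2n)\ne0}}\Big\{\tfrac{2m}{n}:1\le m<\tfrac n2,\ \gcd(m,n)=1\Big\},$$ and the number $N$ of jump discontinuities of $\varphi$ in $(0,1)$ satisfies $N=\frac12\sum_{n\ge3,\ J_\varphi(\frac2n)\ne0}\phi(n)$, where $\phi$ is Euler's totient function.
   Context: $L^2=L^2(0,1)$; each $\varphi\in L^2$ is identified with its odd $2$-periodic extension to $\mathbb{R}$. $\mathcal{C}$ is the set of $\varphi\in L^2$ such that the span of $\{\varphi(kx):k\in\mathbb{N}\}$ is dense in $L^2$. $\mathcal{S}_r$ is the class of step functions on $(0,1)$ (finitely many jumps) all of whose jump discontinuities in $(0,1)$ are rational. $J_\varphi(x)=\varphi(x^+)-\varphi(x^-)$, computed for the odd $2$-periodic extension. *)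

(* Defs.v *)
From HB Require Import structures.
From mathcomp Require Import all_boot all_order all_algebra.
From mathcomp Require Import all_classical all_reals all_analysis.
Set Implicit Arguments. Unset Strict Implicit. Unset Printing Implicit Defensive.
Import Order.TTheory GRing.Theory Num.Theory.
Import numFieldNormedType.Exports.
Local Open Scope classical_set_scope.
Local Open Scope ring_scope.

Section Defs.
Variable R : realType.

Definition I01 : set R := `]0, 1[.

Definition oddext (phi : R -> R) (x : R) : R :=
  let y := x - 2 * (Num.floor (x / 2))%:~R in
  if (0 < y) && (y < 1) then phi y
  else if (1 < y) && (y < 2) then - phi (2 - y)
  else 0.

Definition jump (phi : R -> R) (x : R) : R :=
  lim (oddext phi t @[t --> x^'+]) - lim (oddext phi t @[t --> x^'-]).

Definition L2 (f : R -> R) : Prop :=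
  measurable_fun I01 f /\
  (\int[lebesgue_measure]_(x in I01) ((f x) ^+ 2)%:E < +oo)%E.

Definition inC (phi : R -> R) : Prop :=
  L2 phi /\
  forall f : R -> R, L2 f -> forall eps : R, 0 < eps ->
    exists (K : nat) (c : nat -> R),
      (\int[lebesgue_measure]_(x in I01)
          ((f x - \sum_(1 <= k < K) c k * oddext phi (k%:R * x)) ^+ 2)%:E
        < eps%:E)%E.

Definition step_fun (phi : R -> R) : Prop :=
  exists s : seq R, (forall a, a \in s -> a \in I01) /\
    forall x y, x \in I01 -> y \in I01 ->
      (forall a, a \in s -> ~ (Num.min x y <= a <= Num.max x y)) ->
      phi x = phi y.

Definition is_rational (x : R) : Prop := exists q : rat, x = ratr q.

Definition inSr (phi : R -> R) : Prop :=
  step_fun phi /\ forall x, x \in I01 -> jump phi x != 0 -> is_rational x.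

Definition jumps (phi : R -> R) : set R :=
  [set x | x \in I01 /\ jump phi x != 0].

Definition block (n : nat) : set R :=
  [set x | exists m : nat, [/\ (1 <= m)%N, (2 * m < n)%N, coprime m n &
                             x = (2 * m)%:R / n%:R]].

Definition idx (phi : R -> R) (n : nat) : Prop :=
  (3 <= n)%N /\ jump phi (2 / n%:R) != 0.

End Defs.

(* Main.v *)
Require Import Defs.
From HB Require Import structures.
From mathcomp Require Import all_boot all_order all_algebra.
From mathcomp Require Import all_classical all_reals all_analysis.
From mathcomp Require Import ring lra zify.
From mathcomp Require Import cyclic complex.
Import Order.TTheory GRing.Theory Num.Theory.
Import numFieldNormedType.Exports.
Local Open Scope classical_set_scope.
Local Open Scope ring_scope.
Set Implicit Arguments. Unset Strict Implicit. Unset Printing Implicit Defensive.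

(* Write the odd 2-periodic extension of phi on a grid of step 1/h and let g be its jumps at the
   points r/h, a function on Z/N with N = 2h. The n-th sine coefficient of phi is c(n)/n up to a
   constant, where c is the cosine transform of g, hence N-periodic.

   For z completely multiplicative and absolutely summable, f |-> sum_n z(n) f_n (f_n the sine
   coefficients) is a bounded functional multiplying the value at phi by z(k) when phi is replaced
   by phi(k x). So a cyclic phi satisfies sum_n z(n) c(n)/n <> 0 for all z supported on finitely
   many primes with |z(p)| < 1. With (T_p b)(n) = b(p n), this reads: b(1) <> 0 whenever
   c = prod_p (1 - s_p T_p) b, |s_p| < 1/p.

   Let b be such a sequence. Adding a factor at a prime v shows |b(v)| <= M_v |b(1)| with M_v
   independent of the other factors. Adding factors at many primes p = d mod N, with s_p = zeta/p,
   makes b(v)/b(1) a function of zeta bounded on the unit disc, whose derivative at 0 is proportional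
   to sum 1/p; if that sum can be made arbitrarily large then b(vd) b(1) = b(v) b(d). The classes d
   with divergent sum of 1/p generate the units mod N, since otherwise the integers in a missing class
   would all have a prime factor in a set of primes with convergent sum of 1/p. Hence b/b(1) is a
   character on the units, equal to +-1 as c is real, and factors at arbitrary primes q extend this to
   c(u k) = +-c(k) for all k. Inverting the cosine transform, g(u l) = +-g(l) for u coprime to N: the
   jumps at 2m/n, m coprime to n, vanish or not simultaneously. *)

(** * Primes in residue classes *)

Lemma dvdn_prod_seq (p : nat) (l : seq nat) : p \in l -> (p %| \prod_(q <- l) q)%N.
Proof.
elim: l => // q l IH; rewrite inE big_cons => /orP[/eqP->|/IH]; first exact: dvdn_mulr.
exact: dvdn_mull.
Qed.

Lemma coprime_prod_seq (n : nat) (l : seq nat) :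
  (forall q, q \in l -> coprime n q) -> coprime n (\prod_(q <- l) q)%N.
Proof.
elim: l => [|q l IH] H; first by rewrite big_nil coprimen1.
rewrite big_cons coprimeMr H ?mem_head //= IH // => r rl.
by apply: H; rewrite inE rl orbT.
Qed.

Lemma totient_prod_primes (l : seq nat) : uniq l -> all prime l ->
  totient (\prod_(p <- l) p) = (\prod_(p <- l) p.-1)%N.
Proof.
elim: l => [|p l IH] /=; first by rewrite !big_nil.
move=> /andP[pl ul] /andP[pp al]; rewrite !big_cons totient_coprime.
  by rewrite totient_prime // IH //.
apply: coprime_prod_seq => q ql; rewrite prime_coprime // dvdn_prime2 ?(allP al _ ql) //.
by apply: contraNneq pl => ->.
Qed.

Lemma sum_tail_small (F : archiRealFieldType) (u : nat -> F) (B : F) :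
  (forall x, \sum_(0 <= p < x) u p <= B) -> (forall p, 0 <= u p) ->
  forall e, 0 < e -> exists y, forall x, \sum_(y <= p < x) u p <= e.
Proof.
move=> uB u0 e e0; apply: contrapT => /forallNP big.
have step k : exists y, k%:R * e <= \sum_(0 <= p < y) u p.
  elim: k => [|k [y IH]]; first by exists 0%N; rewrite mul0r big_geq.
  have /existsNP[x /negP] := big y; rewrite -ltNge => ex.
  have yx : (y <= x)%N.
    by rewrite leqNgt; apply/negP => /ltnW xy; move: ex; rewrite big_geq // ltNge (ltW e0).
  exists x; rewrite (big_cat_nat (leq0n y) yx) /= -natr1 mulrDl mul1r lerD //.
  exact: ltW.
have [y] := step (Num.bound (B / e)); apply/negP; rewrite -ltNge.
apply: le_lt_trans (uB y) _; rewrite -ltr_pdivrMr //.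
have [B0|B0] := leP 0 (B / e); first exact: archi_boundP.
exact: lt_le_trans B0 (ler0n _ _).
Qed.

Lemma prod_one_sub_ge (F : realFieldType) (l : seq nat) (u : nat -> F) :
  (forall p, 0 <= u p <= 1) ->
  0 <= \prod_(p <- l) (1 - u p) <= 1 /\ 1 - \sum_(p <- l) u p <= \prod_(p <- l) (1 - u p).
Proof.
move=> H; elim: l => [|p l [/andP[IH0 IH1] IH2]]; first by rewrite !big_nil subr0 ler01 !lexx.
rewrite !big_cons; have /andP[up0 up1] := H p; split; first by apply/andP; split; nra.
nra.
Qed.

Lemma coprime_muln_mod_inj (N u j k : nat) : coprime u N -> (j < N)%N -> (k < N)%N ->
  (u * j = u * k %[mod N])%N -> j = k.
Proof.
move=> uN; wlog kj : j k / (k <= j)%N.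
  move=> W jN kN e; case/orP: (leq_total k j) => ?; [exact: W|apply/esym].
  by apply: W (esym e).
move=> jN kN /eqP; rewrite eqn_mod_dvd ?leq_mul2l ?kj ?orbT // -mulnBr.
rewrite Gauss_dvdr 1?coprime_sym // => /dvdn_leq; case: (posnP (j - k)); first by lia.
by move=> ? /(_ isT); lia.
Qed.

(** Since [N] is a unit mod [Q], [j |-> g + N * j] permutes the residues mod [Q]. *)
Lemma totient_count_shift (N Q g : nat) : (0 < Q)%N -> coprime N Q ->
  (\sum_(0 <= j < Q) coprime (g + N * j) Q = totient Q)%N.
Proof.
move=> Q0 NQ; rewrite totient_count_coprime !big_mkord.
have Q1 (i : nat) : (i %% Q < Q)%N by rewrite ltn_mod.
pose f (j : 'I_Q) : 'I_Q := Ordinal (Q1 (g + N * j)%N).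
rewrite [RHS](reindex_inj (h := f)).
  by apply: eq_bigr => j _ /=; rewrite coprime_modr coprime_sym.
move=> j k /(congr1 val) /= /eqP; rewrite eqn_modDl => /eqP jk; apply/val_inj => /=.
exact: coprime_muln_mod_inj NQ (ltn_ord j) (ltn_ord k) jk.
Qed.

Section UnitsGenerated.
Variables (F : archiRealFieldType) (N : nat) (H : pred nat).
Hypotheses (N0 : (0 < N)%N) (H1 : H 1%N).
Hypothesis HM : forall x y, H x -> H y -> H (x * y)%N.
Hypothesis Hper : forall x y, x = y %[mod N] -> H x -> H y.

Let bad p := [&& prime p, coprime p N & ~~ H p].

(** Strip off prime factors one at a time: if all of them lay in [H], so would [n]. The value
    [n = 0] is coprime to [N] only for [N = 1], and then periodicity puts it in [H]. *)
Lemma bad_prime_factor n : coprime n N -> ~~ H n ->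
  [/\ (0 < n)%N & exists2 p, bad p & (p %| n)%N].
Proof.
have [-> /eqP N1 /negP[]|n0 nN nH] := posnP n; last split=> //.
  by apply: Hper H1; rewrite (_ : N = 1%N) ?modn1 // -N1 gcd0n.
elim/ltn_ind: n n0 nN nH => n IH n0 nN nH; have [n1|n1] := leqP n 1%N.
  by move: nH; rewrite (_ : n = 1%N) ?H1 //; lia.
have pp := pdiv_prime n1; have pn := pdiv_dvd n.
have pN := coprime_dvdl pn nN.
have [Hp|nHp] := boolP (H (pdiv n)); last by exists (pdiv n); rewrite // /bad pp pN.
have E := divnK pn; have m0 : (0 < n %/ pdiv n)%N by rewrite divn_gt0 ?pdiv_gt0 // pdiv_leq.
have [||||q bq qm] := IH (n %/ pdiv n)%N => //.
- by rewrite ltn_Pdiv ?prime_gt1.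
- by apply: coprime_dvdl nN; apply: dvdn_div.
- by apply: contra nH => ?; rewrite -E HM.
by exists q => //; apply: dvdn_trans qm (dvdn_div pn).
Qed.

Lemma sum_progression_le (f : nat -> nat) g Q :
  (\sum_(0 <= j < Q) f (g + N * j) <= \sum_(0 <= n < g + N * Q) f n)%N.
Proof.
elim: Q => [|Q IH]; first by rewrite big_geq.
have le : (g + N * Q < g + N * Q.+1)%N by rewrite mulnS; lia.
rewrite big_nat_recr //= [X in (_ <= X)%N](@big_cat_nat _ _ _ (g + N * Q)) ?(ltnW le) //=.
by apply: leq_add => //; rewrite big_ltn // leq_addr.
Qed.

(* The integers [g + N j] coprime to [Q] still have a bad prime factor, which is at least [y]. *)
Lemma totient_le_bad_tail y g Q : ~~ H g -> coprime g N ->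
  Q = (\prod_(p <- [seq p <- iota 0 y | bad p]) p)%N ->
  (totient Q)%:R / Q%:R <= (g + N)%:R * \sum_(y <= p < g + N * Q | bad p) p%:R^-1 :> F.
Proof.
move=> gH gN QE.
have Q0 : (0 < Q)%N.
  rewrite QE big_seq; apply: prodn_cond_gt0 => p; rewrite mem_filter => /andP[/and3P[pp _ _] _].
  exact: prime_gt0.
have NQ : coprime N Q.
  rewrite QE; apply: coprime_prod_seq => p; rewrite mem_filter => /andP[/and3P[_ pN _] _].
  by rewrite coprime_sym.
set x := (g + N * Q)%N.
(* Double counting of pairs [(j, p)] with [p] dividing [g + N * j]: each [j] counted by [totient Q]
   has a bad prime [p >= y], and each [p] has at most [x %/ p] multiples among the positive integers
   below [x]. *)
have le1 : (totient Q <= \sum_(y <= p < x | bad p) x %/ p)%N.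
  rewrite -(totient_count_shift g Q0 NQ).
  apply: (@leq_trans (\sum_(y <= p < x | bad p) \sum_(0 <= j < Q) ((0 < g + N * j) && (p %| g + N * j)))%N); last first.
    apply: leq_sum => p _.
    apply: leq_trans (sum_progression_le (fun n => ((0 < n) && (p %| n))%N : nat) g Q) _.
    rewrite -/x divn_count_dvd; have [->|x0] := posnP x; first by rewrite big_geq.
    rewrite big_ltn // ltnn add0n [X in (_ <= X)%N]big_nat_recr //=.
    rewrite (eq_big_nat _ _ (F2 := fun n => (p %| n)%N : nat)) ?leq_addr //.
    by move=> i /andP[-> _].
  rewrite exchange_big /= [X in (X <= _)%N]big_nat [X in (_ <= X)%N]big_nat.
  apply: leq_sum => j /andP[_ jQ].
  case nQ: (coprime _ _) => //=.
  have [||n0 [p bp pn]] := @bad_prime_factor (g + N * j)%N.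
  - by rewrite /coprime gcdnC addnC mulnC gcdnMDl gcdnC.
  - by apply: contra gH; apply: Hper; rewrite addnC mulnC modnMDl.
  have px : (p < x)%N.
    apply: leq_ltn_trans (dvdn_leq n0 pn) _.
    by rewrite ltn_add2l ltn_mul2l N0.
  have yp : (y <= p)%N.
    rewrite leqNgt; apply/negP => py; move: nQ; apply/negP.
    rewrite negbT //; apply/negP => nQ; have /and3P[pp _ _] := bp.
    have : coprime p Q by apply: coprime_dvdl nQ.
    rewrite prime_coprime // QE dvdn_prod_seq // mem_filter mem_iota /= add0n py andbT; exact: bp.
  rewrite big_mkcond (bigD1_seq p) /= ?mem_index_iota ?yp ?iota_uniq //.
  by rewrite bp n0 pn.
rewrite ler_pdivrMr ?ltr0n //.
apply: (@le_trans _ _ (\sum_(y <= p < x | bad p) (x %/ p)%N)%:R); first by rewrite ler_nat.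
rewrite natr_sum mulr_sumr mulr_suml.
apply: ler_sum => p /and3P[pp _ _]; have p0 : 0 < p%:R :> F by rewrite ltr0n prime_gt0.
rewrite mulrAC ler_pdivlMr // -!natrM ler_nat.
apply: leq_trans (leq_divM _ _) _.
by rewrite /x mulnDl leq_add2r leq_pmulr.
Qed.

Hypothesis bad_bounded : forall a, coprime a N -> ~~ H a ->
  exists B : F, forall x, \sum_(0 <= p < x | prime p && (p == a %[mod N])%N) p%:R^-1 <= B.

(** Split the bad primes into their finitely many classes mod [N]; a class containing a bad prime is
    coprime to [N] and outside [H], so [bad_bounded] applies to it. *)
Lemma bad_sum_bounded :
  exists B : F, forall x, \sum_(0 <= p < x | bad p) p%:R^-1 <= B.
Proof.
have /boolp.choice[B HB] : forall a, exists B : F, forall x,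
    \sum_(0 <= p < x | bad p && (p %% N == a)%N) p%:R^-1 <= B.
  move=> a; have [/andP[aN Ha]|nHa] := boolP (coprime a N && ~~ H a).
    have [B HB] := bad_bounded aN Ha; exists B => x; apply: le_trans (HB x).
    rewrite big_mkcond [leRHS]big_mkcond; apply: ler_sum => p _.
    case: ifP => [/andP[/and3P[-> _ _] /eqP <-]|_]; first by rewrite modn_mod eqxx.
    by case: ifP => //; rewrite invr_ge0.
  exists 0 => x; rewrite big1 // => p /andP[/and3P[pp pN pH] /eqP pa].
  case/negP: nHa; rewrite -pa coprime_modl pN /=.
  by apply: contra pH; apply: Hper; rewrite modn_mod.
exists (\sum_(a < N) B a) => x.
rewrite (partition_big (fun p : nat => Ordinal (ltn_pmod p N0)) predT) //=.
by apply: ler_sum => a _; apply: HB.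
Qed.

(** The sum of [1/p] over bad primes converges, so [totient Q / Q], the product of [1 - 1/p] over
    bad [p < y], stays away from 0 as [y] grows. A missed class [g] would bound it by a multiple of
    the tail of that sum. *)
Lemma units_generated g : coprime g N -> H g.
Proof.
move=> gN; apply: contrapT => /negP gH.
have [B HB] := bad_sum_bounded.
pose u p : F := if bad p then p%:R^-1 else 0.
have u01 p : 0 <= u p <= 1.
  rewrite /u; case: ifP => [/and3P[pp _ _]|_]; last by rewrite lexx ler01.
  by rewrite invr_ge0 ler0n invf_le1 ?ltr0n ?ler1n ?prime_gt0.
have small := @sum_tail_small F u B.
have {small} small e : 0 < e -> exists y, forall x, \sum_(y <= p < x) u p <= e.
  by apply: small => [x|p]; [rewrite -big_mkcond|case/andP: (u01 p)].
have [y0 Hy0] := small (1/2) ltac:(lra).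
pose d := \prod_(0 <= p < y0) (1 - u p).
have d0 : 0 < d.
  apply: prodr_gt0 => p _; rewrite /u; case: ifP => [/and3P[pp _ _]|_]; last by lra.
  by rewrite subr_gt0 invf_lt1 ?ltr0n ?ltr1n ?prime_gt1 ?prime_gt0.
have gN0 : 0 < (g + N)%:R :> F by rewrite ltr0n addn_gt0 N0 orbT.
(* [y0] costs the product at most a factor 2, giving the lower bound [d / 2]; [y1] brings the upper
   bound down to [d / 4]. *)
have [y1 Hy1] := small (d / 4 / (g + N)%:R) ltac:(by apply: divr_gt0 => //; lra).
pose y := maxn y0 y1.
have := @totient_le_bad_tail y g _ gH gN erefl.
set Q := (\prod_(p <- _) p)%N; set S := \sum_(_ <= p < _ | _) _.
have S1 : S <= d / 4 / (g + N)%:R.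
  rewrite /S big_mkcond -/u; set x := (g + N * Q)%N.
  have [yx|xy] := leqP y x; last first.
    by rewrite big_geq ?(ltnW xy) // ltW // divr_gt0 // divr_gt0.
  apply: le_trans (Hy1 x); rewrite (big_cat_nat (leq_maxr y0 y1) yx) /= lerDr.
  by apply: sumr_ge0 => p _; case/andP: (u01 p).
have QE : (totient Q)%:R / Q%:R = \prod_(0 <= p < y) (1 - u p).
  rewrite /Q totient_prod_primes ?filter_uniq ?iota_uniq //; last first.
    by apply/allP => p; rewrite mem_filter => /andP[/and3P[]].
  rewrite !natr_prod -prodf_div big_filter big_mkcond /index_iota subn0.
  apply: eq_bigr => p _; rewrite /u; case: ifP => [/and3P[pp _ _]|_]; last by rewrite subr0.
  have p0 := prime_gt0 pp; rewrite -subn1 natrB // mulrBl mul1r divff //.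
  by rewrite pnatr_eq0 -lt0n.
have lb : d / 2 <= \prod_(0 <= p < y) (1 - u p).
  rewrite (big_cat_nat (leq0n y0) (leq_maxl y0 y1)) /= -/d ler_wpM2l ?(ltW d0) //.
  apply: le_trans (prod_one_sub_ge _ u01).2.
  by have := Hy0 y; lra.
rewrite QE => up; have := le_trans lb (le_trans up (ler_wpM2l (ltW gN0) S1)).
by rewrite [_%:R * _]mulrC divfK ?gt_eqF //; lra.
Qed.
End UnitsGenerated.

(** * Polynomials without zeros in a disc *)

(** This is [(1 + 1/A)^d <= 1 + 2d/A <= 2] with denominators cleared. *)
Lemma leq_expSn_double (A d : nat) : (2 * d <= A)%N -> (A.+1 ^ d <= 2 * A ^ d)%N.
Proof.
have [->|A0] := posnP A; first by case: d.
move=> dA; suff H n : (n <= d)%N -> (A.+1 ^ n * A <= A ^ n * (A + 2 * n))%N.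
  rewrite -(leq_pmul2r A0); apply: leq_trans (H d (leqnn d)) _.
  by rewrite -[X in (_ <= X)%N]mulnA [X in (_ <= X)%N]mulnCA leq_mul2l; lia.
elim: n => [|n IH] nd; first by rewrite muln0 addn0.
have {}IH := IH (ltnW nd); rewrite !expnS -mulnA.
apply: leq_trans (leq_mul (leqnn _) IH) _.
rewrite mulnCA -[X in (_ <= X)%N]mulnA [X in (_ <= X)%N]mulnCA leq_mul2l; apply/orP; right.
nia.
Qed.

Section ZeroFreePolynomials.
Variable C : numClosedFieldType.
Implicit Types (P F G : {poly C}) (r M : C).

Lemma horner_even_odd P z : P.[z] = (even_poly P).[z ^+ 2] + (odd_poly P).[z ^+ 2] * z.
Proof. by rewrite -{1}(poly_even_odd P) !hornerE !horner_comp !hornerE. Qed.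

Lemma even_poly_le P r M : (forall z, `|z| = r -> `|P.[z]| <= M) ->
  forall w, `|w| = r ^+ 2 -> 0 <= r -> `|(even_poly P).[w]| <= M.
Proof.
move=> PM w wr r0; pose y := sqrtC w.
have y2 : y ^+ 2 = w by rewrite sqrtCK.
have yr : `|y| = r by apply/eqP; rewrite -(@eqrXn2 _ 2) // -normrX y2 wr.
have -> : (even_poly P).[w] = (P.[y] + P.[- y]) / 2.
  rewrite (horner_even_odd P y) (horner_even_odd P (- y)) sqrrN y2.
  by field.
rewrite normrM normfV [`|2|]ger0_norm // ler_pdivrMr // mulr_natr mulr2n.
by apply: le_trans (ler_normD _ _) _; rewrite lerD // PM // normrN.
Qed.

Lemma odd_poly_le P r M : (forall z, `|z| = r -> `|P.[z]| <= M) ->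
  forall w, `|w| = r ^+ 2 -> 0 < r -> `|(odd_poly P).[w]| <= M / r.
Proof.
move=> PM w wr r0; pose y := sqrtC w.
have y2 : y ^+ 2 = w by rewrite sqrtCK.
have yr : `|y| = r by apply/eqP; rewrite -(@eqrXn2 _ 2) ?(ltW r0) // -normrX y2 wr.
have y0 : y != 0 by rewrite -normr_gt0 yr.
have -> : (odd_poly P).[w] = (P.[y] - P.[- y]) / 2 / y.
  rewrite (horner_even_odd P y) (horner_even_odd P (- y)) sqrrN y2.
  by field.
rewrite !normrM !normfV yr ler_pM2r ?invr_gt0 // [`|2|]ger0_norm // ler_pdivrMr //.
rewrite mulr_natr mulr2n.
by apply: le_trans (ler_normB _ _) _; rewrite lerD // PM // normrN.
Qed.

(* Averaging over [z] and [-z] halves the degree, until only the constant term is left. *)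
Lemma coef0_le P r M : 0 <= r -> (forall z, `|z| = r -> `|P.[z]| <= M) -> `|P`_0| <= M.
Proof.
move: {2}(size P) (leqnn (size P)) => n; elim/ltn_ind: n P r => n IH P r sP r0 PM.
have [s1|s1] := leqP (size P) 1.
  have E := size1_polyC s1; rewrite E in PM.
  by have := PM r (ger0_norm r0); rewrite hornerC.
have := IH (uphalf (size P)) _ (even_poly P) (r ^+ 2) (size_even_poly P).
rewrite coef_even_poly; apply; rewrite ?exprn_ge0 //; first by lia.
by move=> z zr; apply: even_poly_le PM _ zr r0.
Qed.

Lemma coef1_le P r M : 0 < r -> (forall z, `|z| = r -> `|P.[z]| <= M) -> `|P`_1| * r <= M.
Proof.
move=> r0 PM; rewrite -ler_pdivlMr // -[1%N]/(0.*2.+1) -coef_odd_poly.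
apply: (@coef0_le _ (r ^+ 2)); first by rewrite exprn_ge0 ?ltW.
by move=> z zr; apply: odd_poly_le PM _ zr r0.
Qed.

Lemma poly_linear_factors P : P`_0 != 0 -> exists l : seq C,
  [/\ size l = (size P).-1, forall a, a \in l -> a != 0 /\ root P a^-1 &
      P = P`_0 *: \prod_(a <- l) (1 - a *: 'X)].
Proof.
move=> P0; have Pn0 : P != 0 by apply: contraNneq P0 => ->; rewrite coef0.
have [s] := closed_field_poly_normal P.
have : lead_coef P != 0 by rewrite lead_coef_eq0.
move: (lead_coef P) => k k0 E.
have rs z : z \in s -> root P z by rewrite E rootZ // root_prod_XsubC.
have s0 z : z \in s -> z != 0.
  by move=> /rs; apply: contraTneq => ->; rewrite /root horner_coef0.
have sE : \prod_(z <- s) ('X - z%:P) =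
    (\prod_(z <- s) - z) *: \prod_(a <- [seq z^-1 | z <- s]) (1 - a *: 'X) :> {poly C}.
  rewrite big_map {rs E}; elim: s s0 => [|z s IH] s0; first by rewrite !big_nil scale1r.
  rewrite !big_cons IH => [|y ys]; last by rewrite s0 // inE ys orbT.
  have -> : 'X - z%:P = - z *: (1 - z^-1 *: 'X).
    rewrite scalerBr scalerA mulNr divff ?s0 ?mem_head // scaleN1r opprK addrC.
    by rewrite alg_polyC polyCN.
  by rewrite -scalerAl -scalerAr scalerA.
exists [seq z^-1 | z <- s]; split.
- by rewrite size_map E size_scale // size_prod_XsubC.
- by move=> _ /mapP[z zs ->]; rewrite invrK invr_eq0 s0 ?rs.
rewrite {1}E sE scalerA; congr (_ *: _).
rewrite -horner_coef0 E sE !hornerZ horner_prod [X in _ = _ * (_ * X)]big1 ?mulr1 // => a _.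
by rewrite !(hornerE, mulr0, oppr0, addr0).
Qed.

Lemma norm_root_inv_le P (r : C) (a : C) : 0 < r -> (forall z, `|z| < r -> P.[z] != 0) ->
  a != 0 -> root P a^-1 -> `|a| <= r^-1.
Proof.
move=> r0 Pz a0 ra; rewrite real_leNgt ?normr_real ?realV ?gtr0_real //.
apply/negP => ar; have /Pz/negP[] : `|a^-1| < r; last exact: ra.
by rewrite normfV invf_plt ?posrE ?normr_gt0.
Qed.

Lemma coef01M (P Q : {poly C}) : (P * Q)`_0 = P`_0 * Q`_0 /\ (P * Q)`_1 = P`_0 * Q`_1 + P`_1 * Q`_0.
Proof. by rewrite !coefM !big_ord_recl !big_ord0 !addr0. Qed.

(** The logarithmic derivative of [P] at 0 is minus the sum of the inverses of its roots, each of
    modulus at most [r^-1]. *)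
Lemma coef1_zero_free P (r : C) : 0 < r -> (forall z, `|z| < r -> P.[z] != 0) ->
  `|P`_1| * r <= (size P).-1%:R * `|P`_0|.
Proof.
move=> r0 Pz; have P0 : P`_0 != 0 by rewrite -horner_coef0 Pz ?normr0.
have [l [sl lP E]] := poly_linear_factors P0.
have {}lP a : a \in l -> `|a| <= r^-1 by move=> /lP[a0 ra]; apply: norm_root_inv_le ra.
rewrite -sl {1}E coefZ normrM -mulrA [leRHS]mulrC ler_wpM2l //.
rewrite -ler_pdivlMr //.
suff: (\prod_(a <- l) (1 - a *: 'X) : {poly C})`_0 = 1 /\
    `|(\prod_(a <- l) (1 - a *: 'X) : {poly C})`_1| <= (size l)%:R / r by case.
elim: l lP {E sl} => [|a l IH] lP; first by rewrite big_nil !coefE normr0 mul0r.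
rewrite big_cons; have [|IH0 IH1] := IH; first by move=> b bl; rewrite lP // inE bl orbT.
have [-> ->] := coef01M (1 - a *: 'X) (\prod_(j <- l) (1 - j *: 'X)).
rewrite IH0 !coefE /= !mulr0 !mulr1 subr0 mul1r sub0r; split=> //.
apply: le_trans (ler_normB _ _) _.
by rewrite /= -natr1 mulrDl mul1r lerD // lP ?mem_head.
Qed.

(* [1 / G] is approximated by the polynomial [H] obtained by truncating the geometric series of
   each linear factor of [G]; Cauchy's estimate for [F * H] then bounds the derivative of [F / G]. *)
Lemma coef1_quotient_le F G M : 0 <= M ->
  (forall z, `|z| < 1 -> G.[z] != 0 /\ `|F.[z]| <= M * `|G.[z]|) ->
  `|F`_1 * G`_0 - F`_0 * G`_1| <= 4 * M * `|G`_0| ^+ 2.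
Proof.
move=> M0 FG; have G0 : G`_0 != 0 by rewrite -horner_coef0; apply: (FG 0 _).1; rewrite normr0.
have [l [_ lG E]] := poly_linear_factors G0.
have {}lG a : a \in l -> `|a| <= 1.
  by move=> /lG[a0 ra]; rewrite -invr1; apply: norm_root_inv_le ra => // z /FG[].
(* [k >= 2] keeps the truncation errors out of the coefficients 0 and 1, and [2 ^ k >= 2 * size l]
   keeps the product of the [1 + 2 ^- k] at most 2 on the circle of radius 1/2. *)
pose k := (size l).+2.
pose H : {poly C} := \prod_(a <- l) \sum_(i < k) (a *: 'X) ^+ i.
have GH : G * H = G`_0 *: \prod_(a <- l) (1 - (a *: 'X) ^+ k).
  rewrite {1}E -scalerAl -big_split /=; congr (_ *: _); apply: eq_bigr => a _.
  by rewrite -[LHS]opprK -mulNr opprB -subrX1 opprB.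
have c01 (a : C) : ((1 - (a *: 'X) ^+ k : {poly C})`_0 = 1) /\ ((1 - (a *: 'X) ^+ k : {poly C})`_1 = 0).
  by rewrite exprZn !coefE /= !mulr0 !subr0.
have [GH0 GH1] : (G * H)`_0 = G`_0 /\ (G * H)`_1 = 0.
  rewrite GH !coefZ.
  suff [-> ->] : (\prod_(a <- l) (1 - (a *: 'X) ^+ k) : {poly C})`_0 = 1 /\
    (\prod_(a <- l) (1 - (a *: 'X) ^+ k) : {poly C})`_1 = 0 by rewrite mulr1 mulr0.
  elim: (l) => [|a l' [IH0 IH1]]; first by rewrite big_nil !coefE.
  rewrite big_cons; set P := \prod_(_ <- _) _ in IH0 IH1 *.
  have [-> ->] := coef01M (1 - (a *: 'X) ^+ k) P.
  by have [-> ->] := c01 a; rewrite IH0 IH1 mulr0 mulr1 mul0r addr0.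
have H0 : H`_0 = 1 by apply: (mulfI G0); rewrite mulr1 -(coef01M _ _).1.
have FH1 : G`_0 * (F * H)`_1 = F`_1 * G`_0 - F`_0 * G`_1.
  move: GH1; rewrite !(coef01M _ _).2 H0 !mulr1 => /eqP; rewrite addr_eq0 => /eqP e.
  by rewrite mulrDr mulrCA e; ring.
have : `|(F * H)`_1| * (1/2) <= 2 * M * `|G`_0|.
  apply: coef1_le => [|z zr]; first by rewrite divr_gt0.
  have z1 : `|z| < 1 by rewrite zr ltr_pdivrMr // mul1r ltr1n.
  have [_ FM] := FG z z1; rewrite hornerM normrM.
  apply: le_trans (ler_wpM2r (normr_ge0 _) FM) _.
  rewrite (_ : M * _ * _ = M * `|(G * H).[z]|); last by rewrite hornerM normrM mulrA.
  rewrite GH hornerZ normrM [2 * M]mulrC -[leRHS]mulrA ler_wpM2l //.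
  rewrite mulrC ler_wpM2r // horner_prod normr_prod.
  apply: (@le_trans _ _ (\prod_(a <- l) (1 + 2^-1 ^+ k))).
    rewrite big_seq [leRHS]big_seq; apply: ler_prod => a al; rewrite normr_ge0 /=.
    have -> : (1 - (a *: 'X) ^+ k).[z] = 1 - a ^+ k * z ^+ k by rewrite exprZn !hornerE.
    apply: le_trans (ler_normB _ _) _.
    rewrite normr1 lerD2l normrM !normrX zr mul1r ler_piMl ?exprn_ge0 ?invr_ge0 //.
    by rewrite exprn_ile1 ?lG.
  rewrite big_const_seq count_predT iter_mulr_1 exprVn.
  have A0 : (2 ^ k)%:R != 0 :> C by rewrite pnatr_eq0 expn_eq0.
  have -> : 1 + 2 ^- k = (2 ^ k).+1%:R / (2 ^ k)%:R :> C.
    by rewrite -[(2 ^ k).+1]addn1 natrD mulrDl divff // mul1r natrX.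
  rewrite expr_div_n ler_pdivrMr -?natrX ?ltr0n ?expn_gt0 // -natrM ler_nat.
  by apply: leq_expSn_double; rewrite /k expnS leq_mul2l /=; have := ltn_expl (size l) (isT : 1 < 2)%N; rewrite expnS; lia.
move=> B; rewrite -FH1 normrM expr2 mulrA [leLHS]mulrC.
rewrite ler_wpM2r // -(@ler_pM2r _ (1/2)) ?divr_gt0 //.
by apply: le_trans B _; rewrite le_eqVlt; apply/orP; left; apply/eqP; field.
Qed.
End ZeroFreePolynomials.

(** * Dilation operators on periodic sequences *)

(** A high power of [q] is 0 modulo the [q]-part of [N]; if the exponent is also a multiple of the
    totient of the remaining part, it is 1 there. Such a power is idempotent mod [N]. *)
Lemma idempotent_expn (N q m : nat) : (0 < N)%N -> prime q ->
  exists K, [/\ (m < K)%N & (q ^ (K + K) = q ^ K %[mod N])%N].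
Proof.
move=> N0 pq; pose N' := (N`_q^')%N.
have N'0 : (0 < N')%N by rewrite part_gt0.
exists (totient N' * (m + logn q N).+1)%N.
have K1 k : (0 < k)%N -> (k <= totient N' * k)%N by move=> k0; rewrite leq_pmull ?totient_gt0.
have := K1 (m + logn q N).+1 isT; set K := (totient N' * _)%N => leK.
split; first by lia.
apply/eqP; rewrite eqn_mod_dvd ?leq_pexp2l ?prime_gt0 ?leq_addr //.
rewrite expnD -[X in (_ - X)%N]muln1 -mulnBr -(partnC q N0).
apply: dvdn_mul; first by rewrite p_part dvdn_exp2l //; lia.
rewrite -eqn_mod_dvd ?expn_gt0 ?prime_gt0 // /K expnM -modnXm.
rewrite Euler_exp_totient; first by rewrite modnXm exp1n.
by rewrite prime_coprime // /N'; have := part_pnat (q^')%N N; rewrite p'natE.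
Qed.

Section GeometricNumerator.
Variables (A : comNzRingType) (q K : nat).

(* The numerator of [(1 - t T)^-1 b] over the denominator [1 - t ^+ K], where [(T b) x = b (q x)]
   and [T ^ (2 K) b = T ^ K b]. *)
Definition geom_num (t : A) (b : nat -> A) (x : nat) : A :=
  (1 - t ^+ K) * (\sum_(j < K) t ^+ j * b (q ^ j * x)%N) +
  t ^+ K * (\sum_(j < K) t ^+ j * b (q ^ (K + j) * x)%N).

Lemma geom_telescope (t : A) (u : nat -> A) n :
  \sum_(j < n) t ^+ j * u j - t * (\sum_(j < n) t ^+ j * u j.+1) = u 0%N - t ^+ n * u n.
Proof.
elim: n => [|n IH]; first by rewrite !big_ord0 mulr0 mul1r !subrr.
rewrite !big_ord_recr /= mulrDr opprD addrACA IH exprS; ring.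
Qed.

(** The terms [b (q ^ (K + j) * x)] have period [K] in [j], so the geometric series in [t T] sums to
    [geom_num] over [1 - t ^+ K]. Telescoping the two halves verifies it. *)
Lemma geom_num_dilate t b x : (forall y, b (q ^ (K + K) * y)%N = b (q ^ K * y)%N) ->
  geom_num t b x - t * geom_num t b (q * x)%N = (1 - t ^+ K) * b x.
Proof.
move=> bK.
have e1 := geom_telescope t (fun j => b (q ^ j * x)%N) K.
have e2 := geom_telescope t (fun j => b (q ^ (K + j) * x)%N) K.
have s i : (q ^ i * (q * x) = q ^ i.+1 * x)%N by rewrite expnSr mulnA.
have -> : geom_num t b (q * x)%N =
    (1 - t ^+ K) * (\sum_(j < K) t ^+ j * b (q ^ j.+1 * x)%N) +
    t ^+ K * (\sum_(j < K) t ^+ j * b (q ^ (K + j.+1) * x)%N).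
  by congr (_ * _ + _ * _); apply: eq_bigr => j _; rewrite s ?addnS.
rewrite /geom_num.
rewrite /= bK addn0 expn0 mul1n in e1 e2; move: e1 e2.
set a := \sum_(j < K) _; set a' := \sum_(j < K) _ => e1.
set d := \sum_(j < K) _; set d' := \sum_(j < K) _ => e2.
have -> : a = b x - t ^+ K * b (q ^ K * x)%N + t * a' by rewrite -e1 subrK.
have -> : d = b (q ^ K * x)%N - t ^+ K * b (q ^ K * x)%N + t * d' by rewrite -e2 subrK.
ring.
Qed.

Lemma geom_num_trunc t b x :
  exists r, geom_num t b x = \sum_(j < K) t ^+ j * b (q ^ j * x)%N + t ^+ K * r.
Proof.
rewrite /geom_num; set s := \sum_(j < K) _; set s' := \sum_(j < K) _.
by exists (s' - s); ring.
Qed.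

End GeometricNumerator.

Lemma geom_num_trunc2 (A : comNzRingType) q K (t : A) b x : (1 < K)%N ->
  exists r, geom_num q K t b x = b x + t * b (q * x)%N + t ^+ 2 * r.
Proof.
case: K => [|[|k]] // _; have [r ->] := geom_num_trunc q k.+2 t b x.
exists (\sum_(j < k) t ^+ j * b (q ^ j.+2 * x)%N + t ^+ k * r).
rewrite !big_ord_recl /= mul1n expn1 mul1r expr1 -!addrA; do 2!congr (_ + _).
rewrite mulrDr mulr_sumr; congr (_ + _); last by rewrite mulrA -exprD.
by apply: eq_bigr => j _; rewrite mulrA -exprD.
Qed.


Lemma geom_num_rmorph (A B : comNzRingType) (f : {rmorphism A -> B}) q K t b x :
  f (geom_num q K t b x) = geom_num q K (f t) (f \o b) x.
Proof.
rewrite /geom_num rmorphD !rmorphM rmorphB rmorph1 rmorphXn !rmorph_sum.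
congr (_ * _ + _ * _); apply: eq_bigr => j _; by rewrite rmorphM rmorphXn.
Qed.

Lemma eq_geom_num (A : comNzRingType) q K (t : A) b b' x : b =1 b' ->
  geom_num q K t b x = geom_num q K t b' x.
Proof. by move=> /funext->. Qed.

Lemma geom_numZ (A : comNzRingType) q K (t k : A) b x :
  geom_num q K t (fun y => k * b y) x = k * geom_num q K t b x.
Proof.
rewrite /geom_num mulrDr mulrCA [k * (t ^+ K * _)]mulrCA.
by congr (_ * _ + _ * _); rewrite mulr_sumr; apply: eq_bigr => j _; rewrite mulrCA.
Qed.

Lemma horner_geom_num (A : comNzRingType) q K (t : A) b x :
  (geom_num q K 'X (polyC \o b) x).[t] = geom_num q K t b x.
Proof.
have := geom_num_rmorph (horner_eval t) q K 'X (polyC \o b) x.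
rewrite /= /horner_eval hornerX => ->.
by apply: eq_geom_num => y /=; rewrite /horner_eval /= hornerC.
Qed.

Lemma coef_geom_num (A : comNzRingType) q K (b : nat -> A) x i : (i < K)%N ->
  (geom_num q K 'X (polyC \o b) x)`_i = b (q ^ i * x)%N.
Proof.
move=> iK; have [r ->] := geom_num_trunc q K 'X (polyC \o b) x.
rewrite coefD coefXnM iK addr0 coef_sum (bigD1 (Ordinal iK)) //=.
rewrite coefXnM ltnn subnn coefC /= big1 ?addr0 // => m mi.
rewrite coefXnM coefC subn_eq0; case: ltnP => // le; case: leqP => // ge.
by case/negP: mi; apply/eqP/val_inj => /=; lia.
Qed.

(** Turns relations known at all small positive [t] into polynomial identities; real [t] also keep
    real sequences real. *)
Lemma poly_eq0_small_real (C : numFieldType) (P : {poly C}) (r : C) : 0 < r ->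
  (forall t, 0 < t -> t < r -> P.[t] = 0) -> P = 0.
Proof.
move=> r0 P0; apply/eqP; apply: contraT => Pn0.
pose rs := [seq r / i.+2%:R | i <- iota 0 (size P)].
have := max_poly_roots Pn0 (rs := rs); rewrite size_map size_iota ltnn; apply.
  apply/allP => _ /mapP[i _ ->]; apply/eqP/P0; first by rewrite divr_gt0.
  by rewrite ltr_pdivrMr // ltr_pMr // ltr1n.
rewrite map_inj_uniq ?iota_uniq // => i j /(mulfI (lt0r_neq0 r0)) /invr_inj /eqP.
by rewrite eqr_nat => /eqP[].
Qed.

Definition mod_periodic (A : Type) (N : nat) (b : nat -> A) :=
  forall m n, (m = n %[mod N])%N -> b m = b n.

(** * Multiplicativity forced by nonvanishing of the Bohr lift *)

Section Peeling.
Variables (C : numClosedFieldType) (N : nat).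
Hypothesis N0 : (0 < N)%N.
Implicit Types (b c : nat -> C) (S : seq (nat * C)).

Definition peel S b : nat -> C :=
  foldr (fun ps b n => b n - ps.2 * b (ps.1 * n)%N) b S.

Definition admissible S :=
  uniq (unzip1 S) && all (fun ps => prime ps.1 && (`|ps.2| * ps.1%:R < 1)) S.

(* Nonvanishing of the Bohr lift of [sum_n c n / n * n ^- s] at the points of the polydisc with
   finite support: when [c = peel S b], the value of the lift at the point [(p * s)_((p, s) \in S)]
   is [b 1]. *)
Definition zero_free c := forall S b, admissible S -> mod_periodic N b -> c =1 peel S b -> b 1%N != 0.

Lemma eq_peel S b b' : b =1 b' -> peel S b =1 peel S b'.
Proof. by elim: S => //= ps S IH /IH E n; rewrite !E. Qed.

Lemma peel_rcons S p t b :
  peel (rcons S (p, t)) b = peel S (fun n => b n - t * b (p * n)%N).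
Proof. by rewrite /peel foldr_rcons. Qed.

Lemma geom_num_periodic (A : comNzRingType) d K (t : A) (b : nat -> A) :
  mod_periodic N b -> mod_periodic N (geom_num d K t b).
Proof.
move=> bN x y xy; rewrite /geom_num; congr (_ * _ + _ * _); apply: eq_bigr => j _;
by congr (_ * _); apply: bN; rewrite -modnMmr xy modnMmr.
Qed.

Variable c : nat -> C.
Hypothesis c_zero_free : zero_free c.

(** These [b] arise from [c] by inverting the factors [1 - s T_p] listed in [S]. The arguments below
    add further primes to [S] and use that [b 1] never vanishes. *)
Let reach S b := [/\ admissible S, mod_periodic N b & c =1 peel S b].

Lemma reach_neq0 S b : reach S b -> b 1%N != 0.
Proof. by case=> ? ? ?; apply: (c_zero_free (S := S)). Qed.

(** On [N]-periodic sequences [T_p = T_d], so [1 - t T_p] is inverted by the closed form in [d].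
    This lets many primes of one class share the same [d] and [K]. *)
Lemma reach_geom S b p d K t : reach S b -> prime p -> p \notin unzip1 S ->
  (p = d %[mod N])%N -> (d ^ (K + K) = d ^ K %[mod N])%N -> (0 < K)%N -> `|t| < p%:R^-1 ->
  exists b', [/\ 1 - t ^+ K != 0, reach (rcons S (p, t)) b',
    forall x, b' x = geom_num d K t b x / (1 - t ^+ K) &
    forall x, geom_num d K t b x = (1 - t ^+ K) * b' x].
Proof.
move=> [aS bN cE] pp pS pd dK K0 tp.
have p0 : 0 < p%:R :> C by rewrite ltr0n prime_gt0.
have tp1 : `|t| * p%:R < 1 by rewrite -ltr_pdivlMr // mul1r.
have t1 : `|t| < 1.
  by apply: lt_le_trans tp _; rewrite invf_le1 // ler1n prime_gt0.
have k0 : 1 - t ^+ K != 0.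
  rewrite subr_eq0; apply: contraTneq t1 => tK.
  have : `|t| ^+ K = 1 by rewrite -normrX -tK normr1.
  by move=> /eqP; rewrite pexpr_eq1 ?normr_ge0 // => /eqP->; rewrite ltxx.
have per y : b (d ^ (K + K) * y)%N = b (d ^ K * y)%N.
  by apply: bN; rewrite -modnMml dK modnMml.
exists (fun x => geom_num d K t b x / (1 - t ^+ K)); split=> // [|x]; last first.
  by rewrite mulrCA divff // mulr1.
have gN := geom_num_periodic d K t bN.
split.
- rewrite /admissible /unzip1 map_rcons rcons_uniq all_rcons /= -/(unzip1 S) pS pp tp1 /=.
  exact: aS.
- by move=> x y xy; rewrite (gN _ _ xy).
move=> n; rewrite peel_rcons cE; apply: eq_peel => x.
have -> : geom_num d K t b (p * x)%N = geom_num d K t b (d * x)%N.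
  by apply: gN; rewrite -modnMml pd modnMml.
by rewrite mulrA -mulrBl geom_num_dilate // mulrAC divff // mul1r.
Qed.

(** As a polynomial in [t], the numerator at [x = 1] starts with [b 1 + b p * t], has degree at most
    [2 K], and has no zero in [|t| < 1/p]; [coef1_zero_free] applies. Neither [K] nor the radius
    depends on [S] or [b]. *)
Lemma reach_bound p : prime p -> exists2 M, 0 <= M &
  forall S b, reach S b -> p \notin unzip1 S -> `|b p| <= M * `|b 1%N|.
Proof.
move=> pp; have [K [K1 pK]] := idempotent_expn 1 N0 pp.
have p0 : 0 < p%:R :> C by rewrite ltr0n prime_gt0.
exists ((K + K)%:R * p%:R) => [|S b rb pS]; first by rewrite mulr_ge0.
pose P := geom_num p K 'X (polyC \o b) 1.
have Pz t : `|t| < p%:R^-1 -> P.[t] != 0.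
  move=> tp; have [b' [k0 rb' _ PK]] := reach_geom rb pp pS erefl pK (ltnW K1) tp.
  by rewrite horner_geom_num PK mulf_neq0 //; apply: reach_neq0 rb'.
have P0 : P`_0 = b 1%N by rewrite coef_geom_num ?expn0 // ltnW.
have P1 : P`_1 = b p by rewrite coef_geom_num // muln1 expn1.
have := coef1_zero_free _ Pz; rewrite invr_gt0 p0 P0 P1 => /(_ isT).
rewrite ler_pdivrMr // mulrAC => /le_trans; apply.
rewrite !ler_wpM2r // ?(ltW p0) // ler_nat -subn1 leq_subLR.
apply/leqW; have sum_size (u : nat -> C) :
    (size (\sum_(j < K) 'X^j * (u j)%:P : {poly C})%R <= K)%N.
  have -> : (\sum_(j < K) 'X^j * (u j)%:P : {poly C}) = \poly_(j < K) u j.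
    by rewrite poly_def; apply: eq_bigr => j _; rewrite mulrC mul_polyC.
  exact: size_poly.
apply: leq_trans (size_polyD _ _) _; rewrite geq_max; apply/andP; split.
  apply: leq_trans (size_polyMleq _ _) _.
  have := sum_size (fun j => b (p ^ j * 1)%N); have : (size (1 - 'X^K : {poly C})%R <= K.+1)%N.
    apply: leq_trans (size_polyD _ _) _.
    by rewrite size_polyN size_polyXn size_poly1 geq_max leqnn.
  by move: (size _) (size _) => x y ? ?; lia.
apply: leq_trans (size_polyMleq _ _) _; rewrite size_polyXn.
by have := sum_size (fun j => b (p ^ (K + j) * 1)%N); move: (size _) => x ?; lia.
Qed.

(** All primes of [P] receive a factor at once, with [s_p = z / p] for a common variable [z], up to
    the denominators [1 - s_p ^+ K]. *)
Let geom_fold d K P b : nat -> {poly C} :=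
  foldr (fun p => geom_num d K (p%:R^-1 *: 'X)) (polyC \o b) P.

Lemma geom_fold_horner d K P S b z : reach S b -> `|z| < 1 ->
  (d ^ (K + K) = d ^ K %[mod N])%N -> (0 < K)%N ->
  uniq P -> all (fun p => [&& prime p, p == d %[mod N] & p \notin unzip1 S]) P ->
  exists S' b' k, [/\ reach S' b', k != 0, unzip1 S' =i P ++ unzip1 S &
    forall x, (geom_fold d K P b x).[z] = k * b' x].
Proof.
move=> rb z1 dK K0; elim: P => [|p P IH] /=.
  move=> _ _; exists S, b, 1; split; rewrite ?oner_eq0 // => x.
  by rewrite /= hornerC mul1r.
move=> /andP[pP uP] /andP[/and3P[pp /eqP pd pS] aP].
have [S' [b' [k [rb' k0 SP PE]]]] := IH uP aP.
have p0 : 0 < p%:R :> C by rewrite ltr0n prime_gt0.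
have tp : `|z / p%:R| < p%:R^-1.
  by rewrite normrM normfV normr_nat gtr_pMl ?invr_gt0.
have pS' : p \notin unzip1 S' by rewrite SP mem_cat negb_or pP pS.
have [b'' [k1 rb'' _ E]] := reach_geom rb' pp pS' pd dK K0 tp.
exists (rcons S' (p, z / p%:R)), b''.
exists (k * (1 - (z / p%:R) ^+ K)); split=> //; first by rewrite mulf_neq0.
  by move=> x; rewrite /unzip1 map_rcons mem_rcons !inE SP.
move=> x; have := geom_num_rmorph (horner_eval z) d K (p%:R^-1 *: 'X) (geom_fold d K P b) x.
rewrite /= /horner_eval hornerZ hornerX mulrC => ->.
rewrite (eq_geom_num _ _ _ _ (b' := fun y => k * b' y)) => [|y /=]; last exact: PE.
by rewrite geom_numZ -mulrA E.
Qed.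

(** To first order in [z] each prime [p] contributes [(z / p) T_d], which is how the sum of [1/p]
    enters. *)
Lemma geom_fold_coef d K P b x : (1 < K)%N ->
  (geom_fold d K P b x)`_0 = b x /\
  (geom_fold d K P b x)`_1 = (\sum_(p <- P) p%:R^-1) * b (d * x)%N.
Proof.
move=> K1; elim: P x => [|p P IH] x; first by rewrite big_nil mul0r !coefC.
rewrite /=; have [r ->] := geom_num_trunc2 d (p%:R^-1 *: 'X) (geom_fold d K P b) x K1.
have [E0 E1] := IH x; have [F0 _] := IH (d * x)%N.
rewrite -!scalerAl exprZn -scalerAl !coefD !coefZ !coefXM !coefXnM /= E0 E1 F0 !mulr0 !addr0.
by rewrite big_cons mulrDl addrC.
Qed.

(** Divergence of the sum of [1/p] over the class of [d], phrased so that the primes chosen avoid a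
    given finite list, such as those already in [S]. *)
Definition divergent (d : nat) := forall (l : seq nat) (B : C), B \is Num.real ->
  exists P, [/\ uniq P, all (fun p => [&& prime p, p == d %[mod N] & p \notin l]) P &
    B <= \sum_(p <- P) p%:R^-1].

Lemma divergent_prime d (l : seq nat) : divergent d ->
  exists p, [/\ prime p, (p = d %[mod N])%N & p \notin l].
Proof.
move=> /(_ l 1 (ger0_real ler01))[[|p P] [_ /= aP]]; first by rewrite big_nil ler10.
by case/andP: aP => /and3P[pp /eqP pd pl] _ _; exists p.
Qed.

(** The quotient [F / G] in [z] is bounded by [M] on the unit disc, and its derivative at 0 is
    [s * D / b 1 ^+ 2] with [s] the sum of [1/p]. As [s] can be made arbitrarily large, [D = 0]. *)
Lemma reach_divergentM S b v d : reach S b -> prime v -> v \notin unzip1 S -> prime d -> divergent d ->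
  b (v * d)%N * b 1%N = b v * b d.
Proof.
move=> rb pv vS pd dd; have [K [K1 dK]] := idempotent_expn 1 N0 pd.
have [M M0 HM] := reach_bound pv.
pose D := b (v * d)%N * b 1%N - b v * b d.
suff : D = 0 by move/eqP; rewrite subr_eq0 => /eqP.
apply/eqP; apply: contraT => D0.
(* Chosen so that [B * |D|] exceeds by 1 the bound of [coef1_quotient_le]. *)
pose B := (4 * M * `|b 1%N| ^+ 2 + 1) / `|D|.
have Br : B \is Num.real.
  by rewrite realM ?realV ?realD ?realM ?realX ?normr_real ?ger0_real.
have [P [uP aP BP]] := dd (v :: unzip1 S) B Br.
pose F := geom_fold d K P b v; pose G := geom_fold d K P b 1.
have := @coef1_quotient_le C F G M M0.
have [-> ->] := geom_fold_coef d P b v K1; have [-> ->] := geom_fold_coef d P b 1 K1.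
set s := \sum_(p <- P) _.
have -> : s * b (d * v)%N * b 1%N - b v * (s * b (d * 1)%N) = s * D.
  by rewrite /D muln1 [(d * v)%N]mulnC; ring.
have FG z : `|z| < 1 -> G.[z] != 0 /\ `|F.[z]| <= M * `|G.[z]|.
  move=> z1; have [|S' [b' [k [rb' k0 SP E]]]] := geom_fold_horner rb z1 dK (ltnW K1) uP.
    apply/allP => p /(allP aP); rewrite inE negb_or => /and4P[-> -> _ ->]; exact: isT.
  rewrite !E; split; first by rewrite mulf_neq0 // (reach_neq0 rb').
  rewrite !normrM mulrCA ler_wpM2l //; apply: HM rb' _.
  rewrite SP mem_cat negb_or vS andbT; apply/negP => /(allP aP).
  by rewrite inE eqxx !andbF.
move=> /(_ FG) le; suff /lt_geF : 4 * M * `|b 1%N| ^+ 2 < `|s * D| by rewrite le.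
rewrite normrM; apply: (@lt_le_trans _ _ (B * `|D|)).
  by rewrite divfK ?normr_eq0 // ltrDl.
have s0 : 0 <= s by apply: sumr_ge0 => p _; rewrite invr_ge0.
by rewrite ler_wpM2r // ger0_norm.
Qed.

Let words (l : seq nat) := forall d, d \in l -> prime d /\ divergent d.

(* Comparing, in the power series in [t] of [b_t = (1 - t T_d)^-1 b], the coefficients of [t] on
   the two sides of the relation for [w] gives the relation for [d * w]. *)
Lemma reach_wordM S b v l : words l -> reach S b -> prime v -> v \notin unzip1 S ->
  b (v * \prod_(d <- l) d)%N * b 1%N = b v * b (\prod_(d <- l) d)%N.
Proof.
elim: l S b => [|d l IH] S b wl rb pv vS; first by rewrite big_nil muln1.
have [pd dd] := wl d (mem_head _ _).
have {}IH S' b' : reach S' b' -> v \notin unzip1 S' ->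
    b' (v * \prod_(d <- l) d)%N * b' 1%N = b' v * b' (\prod_(d <- l) d)%N.
  by move=> rb' vS'; apply: IH rb' pv vS' => e el; apply: wl; rewrite inE el orbT.
rewrite big_cons; set w := (\prod_(d <- l) d)%N in IH *.
have [p [pp pdE]] := divergent_prime (v :: unzip1 S) dd; rewrite inE negb_or => /andP[pv' pS].
have [K [K1 dK]] := idempotent_expn 1 N0 pd.
have p0 : 0 < p%:R^-1 :> C by rewrite invr_gt0 ltr0n prime_gt0.
pose n x := geom_num d K 'X (polyC \o b) x.
have nE t x : (n x).[t] = geom_num d K t b x by exact: horner_geom_num.
have rel : n (v * w)%N * n 1%N = n v * n w.
  apply/eqP; rewrite -subr_eq0; apply/eqP/(poly_eq0_small_real p0) => t t0 tp.
  have tp' : `|t| < p%:R^-1 by rewrite gtr0_norm.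
  have [b' [k0 rb' _ E]] := reach_geom rb pp pS pdE dK (ltnW K1) tp'.
  have vS' : v \notin unzip1 (rcons S (p, t)).
    by rewrite /unzip1 map_rcons mem_rcons inE negb_or vS eq_sym pv'.
  have := IH _ _ rb' vS'; rewrite hornerD hornerN !hornerM !nE !E.
  move: (1 - t ^+ K) => k1 R.
  have -> : k1 * b' (v * w)%N * (k1 * b' 1%N) - k1 * b' v * (k1 * b' w) =
     k1 ^+ 2 * (b' (v * w)%N * b' 1%N - b' v * b' w) by ring.
  by rewrite R subrr mulr0.
have n0 x : (n x)`_0 = b x by rewrite coef_geom_num ?expn0 ?mul1n // ltnW.
have n1 x : (n x)`_1 = b (d * x)%N by rewrite coef_geom_num // expn1.
have rel1 : (n (v * w)%N * n 1%N)`_1 = (n v * n w)`_1 by rewrite rel.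
move: rel1; rewrite !(coef01M _ _).2 !n0 !n1 muln1 => rel1.
have b1 := reach_neq0 rb; apply: (mulIf b1).
have Rd := reach_divergentM rb pv vS pd dd; have Rw := IH _ _ rb vS.
rewrite mulnCA; move: Rd; rewrite [(v * d)%N]mulnC => Rd.
have -> : b (d * (v * w))%N * b 1%N = b v * b (d * w)%N + b (d * v)%N * b w - b (v * w)%N * b d.
  by rewrite -rel1; ring.
have -> : (b v * b (d * w)%N + b (d * v)%N * b w - b (v * w)%N * b d) * b 1%N =
    b v * b (d * w)%N * b 1%N + b (d * v)%N * b 1%N * b w - b (v * w)%N * b 1%N * b d by ring.
by rewrite Rd Rw; ring.
Qed.

Hypothesis words_generate : forall u, coprime u N ->
  exists2 l, words l & (u = \prod_(d <- l) d %[mod N])%N.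

Lemma reach_unitM S b x u : reach S b -> coprime x N -> coprime u N ->
  b (x * u)%N * b 1%N = b x * b u.
Proof.
move=> rb xN uN; have [_ bN _] := rb; have b1 := reach_neq0 rb.
have [l wl lE] := words_generate xN; have [m wm mE] := words_generate uN.
rewrite (bN _ _ lE) (bN _ _ mE) (bN (x * u)%N (\prod_(d <- l) d * \prod_(d <- m) d)%N); last first.
  by rewrite -modnMm lE mE modnMm.
elim: l wl {x xN lE} => [|d l IH] wl; first by rewrite big_nil mul1n mulrC.
have wl' : words l by move=> e el; apply: wl; rewrite inE el orbT.
have [pd dd] := wl d (mem_head _ _).
have [p [pp pdE pS]] := divergent_prime (unzip1 S) dd.
have dp y : b (d * y)%N = b (p * y)%N by apply: bN; rewrite -modnMml -pdE modnMml.
have wlm : words (l ++ m) by move=> e; rewrite mem_cat => /orP[/wl'|/wm].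
rewrite big_cons -mulnA !dp; apply: (mulIf b1).
have := reach_wordM wlm rb pp pS; rewrite big_cat /= => ->.
have E := reach_wordM wl' rb pp pS.
by rewrite [RHS]mulrAC E -!mulrA (IH wl').
Qed.

(** On units [b / b 1] is a character of a finite group, so its values are roots of unity; real ones
    are 1 or -1. *)
Lemma reach_unitX S b u : reach S b -> coprime u N -> (forall n, b n \is Num.real) ->
  b u ^+ 2 = b 1%N ^+ 2.
Proof.
move=> rb uN br; have [_ bN _] := rb; have b1 := reach_neq0 rb.
have E k : b (u ^ k)%N * b 1%N ^+ k = b u ^+ k * b 1%N.
  elim: k => [|k IH]; first by rewrite !expr0 mulr1 mul1r.
  rewrite expnSr exprSr mulrA mulrAC (reach_unitM rb) ?coprimeXl // mulrAC IH.
  by rewrite exprSr; ring.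
have [k k0 uk] : exists2 k, (0 < k)%N & (u ^ k = 1 %[mod N])%N.
  by exists (totient N); [rewrite totient_gt0|exact: Euler_exp_totient].
have := E k; rewrite (bN _ _ uk) mulrC => /(mulIf b1) /(congr1 Num.norm).
rewrite !normrX => /eqP; rewrite eqrXn2 // => /eqP e.
by rewrite -(real_normK (br u)) -(real_normK (br 1%N)) e.
Qed.

(** Induction on the primes of [k]. A factor with parameter [t] at [q] turns [b] into a power series
    in [t] whose [j]-th coefficient at [x] is [b (q ^ j * x)]; the relation for the [q]-free part of
    [k], valid for all small real [t], yields the one for [k]. *)
Lemma reach_realM (Q : seq nat) S b k u : uniq Q -> all prime Q -> reach S b ->
  (forall n, b n \is Num.real) -> {in Q, forall q, q \notin unzip1 S} ->
  (0 < k)%N -> {subset primes k <= Q} -> coprime u N ->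
  b (u * k)%N * b 1%N = b u * b k.
Proof.
move=> uQ aQ rb br QS k0 kQ uN; elim: Q uQ aQ S b rb br QS k k0 kQ => [|q Q IH] /=.
  move=> _ _ S b rb br _ k k0 kQ; have -> : k = 1%N.
    case: k k0 kQ => [|[|k]] // _ /(_ (pdiv k.+2)).
    by rewrite mem_primes pdiv_prime ?pdiv_dvd // => /(_ isT).
  by rewrite muln1.
move=> /andP[qQ uQ] /andP[pq aQ] S b rb br QS k k0 kQ.
pose j := logn q k; pose k' := (k`_q^')%N.
have kE : k = (q ^ j * k')%N by rewrite -p_part partnC.
have [K [jK qK]] := idempotent_expn j.+1 N0 pq.
have K0 : (0 < K)%N by lia.
have qr0 : 0 < q%:R^-1 :> C by rewrite invr_gt0 ltr0n prime_gt0.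
have qS : q \notin unzip1 S by apply: QS; apply: mem_head.
pose n x := geom_num q K 'X (polyC \o b) x.
have nE t x : (n x).[t] = geom_num q K t b x by exact: horner_geom_num.
have nX i x : (i < K)%N -> (n x)`_i = b (q ^ i * x)%N by exact: coef_geom_num.
clearbody n.
have small t : 0 < t -> t < q%:R^-1 -> exists (k1 : C) S' b',
    [/\ reach S' b', forall n, b' n \is Num.real, {in Q, forall r, r \notin unzip1 S'} &
        forall x, (n x).[t] = k1 * b' x].
  move=> t0 tq; have tq' : `|t| < q%:R^-1 by rewrite gtr0_norm.
  have [b' [k1 rb' bE E]] := reach_geom rb pq qS erefl qK K0 tq'.
  exists (1 - t ^+ K), (rcons S (q, t)), b'.
  have tr : t \is Num.real by rewrite gtr0_real.
  split=> // [x|r rQ|x]; last by rewrite nE E.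
    rewrite bE realM ?realV ?realB ?realX ?real1 // /geom_num.
    by rewrite realD // realM ?realB ?realX ?real1 // sum_real // => i _; rewrite realM ?realX.
  rewrite /unzip1 map_rcons mem_rcons inE negb_or -/(unzip1 S) QS ?inE ?rQ ?orbT // andbT.
  by apply: contraNneq qQ => /= <-.
have b1 := reach_neq0 rb.
have n1 : n 1%N != 0.
  by apply: contraNneq b1 => n1; have := nX 0%N 1%N K0; rewrite n1 coef0 expn0 mul1n => <-.
(* For each small [t] the values at [u] and 1 agree up to a sign that might depend on [t]. The
   product of the two polynomial relations vanishes identically, so one sign serves all [t]. *)
have [e nu] : exists e, n u = e *: n 1%N.
  have : (n u - n 1%N) * (n u + n 1%N) = 0.
    apply: (poly_eq0_small_real qr0) => t t0 tq.
    have [k1 [S' [b' [rb' br' _ E]]]] := small t t0 tq.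
    have := reach_unitX rb' uN br'.
    rewrite hornerM !hornerD hornerN !E => sq.
    have -> : (k1 * b' u - k1 * b' 1%N) * (k1 * b' u + k1 * b' 1%N) =
       k1 ^+ 2 * (b' u ^+ 2 - b' 1%N ^+ 2) by ring.
    by rewrite sq subrr mulr0.
  move/eqP; rewrite mulf_eq0 => /orP[]; [rewrite subr_eq0|rewrite addr_eq0] => /eqP ->.
    by exists 1; rewrite scale1r.
  by exists (-1); rewrite scaleN1r.
have rel : n (u * k')%N * n 1%N = n u * n k'.
  apply/eqP; rewrite -subr_eq0; apply/eqP/(poly_eq0_small_real qr0) => t t0 tq.
  have [k1 [S' [b' [rb' br' QS' E]]]] := small t t0 tq.
  have R : b' (u * k')%N * b' 1%N = b' u * b' k'.
    apply: (IH _ _ _ _ rb' br' QS'); rewrite ?part_gt0 //.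
    move=> r; rewrite primes_part mem_filter => /andP[rq /kQ].
    by rewrite inE => /orP[/eqP e'|//]; move: rq; rewrite e' !inE eqxx.
  rewrite hornerD hornerN !hornerM !E.
  have -> : k1 * b' (u * k')%N * (k1 * b' 1%N) - k1 * b' u * (k1 * b' k') =
     k1 ^+ 2 * (b' (u * k')%N * b' 1%N - b' u * b' k') by ring.
  by rewrite R subrr mulr0.
have nuk : n (u * k')%N = e *: n k'.
  by apply: (mulIf n1); rewrite rel nu -scalerAl mulrC scalerAl.
have bu : b u = e * b 1%N.
  by have := nX 0%N u K0; rewrite nu coefZ nX // !expn0 !mul1n => <-.
have buk : b (u * k)%N = e * b k.
  have jK' : (j < K)%N by lia.
  by have := nX j (u * k')%N jK'; rewrite nuk coefZ nX // kE mulnCA => <-.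
by rewrite bu buk mulrAC.
Qed.

Theorem zero_free_semicharacter : mod_periodic N c -> (forall n, c n \is Num.real) ->
  forall u, coprime u N -> exists2 e : C, e ^+ 2 = 1 & forall k, (0 < k)%N -> c (u * k)%N = e * c k.
Proof.
move=> cN cr u uN; have rc : reach [::] c by split.
have c1 := reach_neq0 rc.
exists (c u / c 1%N).
  by rewrite expr_div_n (reach_unitX rc uN cr) divff // expf_neq0.
move=> k k0; apply: (mulIf c1); rewrite mulrAC divfK //.
apply: (reach_realM (primes_uniq k) _ rc cr) => //.
by apply/allP => p; rewrite mem_primes => /andP[].
Qed.
End Peeling.

Lemma unbounded_divergent (R : realType) (N a : nat) :
  ~ (exists B : R, forall x, \sum_(0 <= p < x | prime p && (p == a %[mod N])%N) p%:R^-1 <= B) ->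
  divergent R[i] N a.
Proof.
move=> unb l B Br; have [x xB] : exists x, complex.Re B + (size l)%:R <
    \sum_(0 <= p < x | prime p && (p == a %[mod N])%N) p%:R^-1.
  apply: contrapT => /forallNP H; apply: unb; exists (complex.Re B + (size l)%:R) => x.
  by rewrite leNgt; apply/negP/H.
exists [seq p <- index_iota 0 x | [&& prime p, p == a %[mod N] & p \notin l]%N]; split.
- by rewrite filter_uniq // iota_uniq.
- by apply/allP => p; rewrite mem_filter => /andP[].
rewrite -(RRe_real Br) big_filter.
have -> : \sum_(0 <= p < x | [&& prime p, p == a %[mod N] & p \notin l]%N) p%:R^-1 =
   (\sum_(0 <= p < x | [&& prime p, p == a %[mod N] & p \notin l]%N) p%:R^-1)%:C%C :> R[i].
  by rewrite rmorph_sum; apply: eq_bigr => p _; rewrite fmorphV rmorph_nat.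
rewrite lecR -(lerD2r (size l)%:R); apply: le_trans (ltW xB) _.
rewrite (bigID (mem l)) /= addrC lerD //.
  by rewrite big_mkcond [leRHS]big_mkcond; apply: ler_sum => p _; rewrite -andbA.
apply: (@le_trans _ _ (\sum_(0 <= p < x | p \in l) 1%N%:R)).
  rewrite big_mkcond [leRHS]big_mkcond; apply: ler_sum => p _.
  case: (p \in l); rewrite ?andbF ?andbT //; case: ifP => [/andP[pp _]|] //.
  by rewrite invf_le1 ?ltr0n ?ler1n ?prime_gt0.
rewrite -natr_sum sum1_count -size_filter ler_nat; apply: uniq_leq_size.
  by rewrite filter_uniq // iota_uniq.
by move=> p; rewrite mem_filter => /andP[].
Qed.

(** [units_generated] for the set of classes that are products of divergent primes: a class with
    unbounded sum contains a prime, which is itself a one-letter word. *)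
Lemma divergent_words (R : realType) (N u : nat) : (0 < N)%N -> coprime u N ->
  exists2 l, (forall d, d \in l -> prime d /\ divergent R[i] N d) &
    (u = \prod_(d <- l) d %[mod N])%N.
Proof.
move=> N0 uN; pose H u := `[< exists2 l, (forall d, d \in l -> prime d /\ divergent R[i] N d) &
    (u = \prod_(d <- l) d %[mod N])%N >].
suff /asboolP : H u by [].
apply: (@units_generated R N H N0) => //.
- by apply/asboolP; exists [::]; rewrite ?big_nil.
- move=> x y /asboolP[l Hl xl] /asboolP[m Hm ym]; apply/asboolP; exists (l ++ m).
    by move=> d; rewrite mem_cat => /orP[/Hl|/Hm].
  by rewrite big_cat /= -modnMm xl ym modnMm.
- by move=> x y xy /asboolP[l Hl xl]; apply/asboolP; exists l; rewrite -?xy.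
move=> a aN /asboolP nH; apply: contrapT => /unbounded_divergent D; apply: nH.
have [p [pp pa _]] := divergent_prime [::] D; exists [:: p]; last by rewrite big_seq1.
move=> d; rewrite inE => /eqP->; split=> // l B /D-/(_ l)[P [uP aP BP]]; exists P; split=> //.
by apply: sub_all aP => q; rewrite pa.
Qed.

Theorem zero_free_sign (R : realType) (N : nat) (c : nat -> R) : (0 < N)%N ->
  mod_periodic N c -> zero_free N (fun n => (c n)%:C%C) ->
  forall u, coprime u N -> exists2 e : R, e != 0 & forall k, (0 < k)%N -> c (u * k)%N = e * c k.
Proof.
move=> N0 cN zf u uN.
have [|||e e2 H] := @zero_free_semicharacter R[i] N N0 _ zf _ _ _ u uN.
- by move=> v vN; apply: divergent_words.
- by move=> m n mn; rewrite (cN _ _ mn).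
- by move=> n; apply/complex_realP; exists (c n).
have c1 : c 1%N != 0.
  have : (c 1%N)%:C%C != 0 :> R[i].
    by apply: (zf [::] (fun n => (c n)%:C%C)) => // m n mn; rewrite (cN _ _ mn).
  by apply: contraNneq => ->.
have Ec k : (0 < k)%N -> c (u * k)%N = complex.Re e * c k.
  move=> k0; have := H k k0 => /(congr1 (@complex.Re R)) /=.
  by case: (e) => er ei /=; rewrite mulr0 subr0.
exists (complex.Re e) => //; apply: contraNneq c1 => e0.
have := H 1%N isT; have := Ec 1%N isT; rewrite e0 mul0r => -> /esym/eqP.
rewrite mulf_eq0 => /orP[/eqP e0'|]; last by rewrite fmorph_eq0.
by move: e2; rewrite e0' expr0n /= => /eqP; rewrite eq_sym oner_eq0.
Qed.

(** * Evaluation of the Bohr lift *)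

Lemma sum_multiples (A : nmodType) (F : nat -> A) (p M : nat) : (0 < p)%N ->
  \sum_(1 <= n < M.+1 | (p %| n)%N) F n = \sum_(1 <= m < (M %/ p).+1) F (p * m)%N.
Proof.
move=> p0; elim: M => [|M IH]; first by rewrite div0n !big_geq.
rewrite big_mkcond big_nat_recr //= -big_mkcond IH divnS //.
case: ifP => pM; last by rewrite add0n addr0.
have e : (p * (M %/ p).+1 = M.+1)%N by have := divnK pM; rewrite divnS // pM mulnC.
by rewrite add1n [RHS]big_nat_recr //= e.
Qed.

Section LiftEvaluation.
Variable C : numClosedFieldType.
Implicit Types (S : seq (nat * C)) (b c : nat -> C).

Lemma admissible_cons S p s : admissible ((p, s) :: S) =
  [&& p \notin unzip1 S, prime p, `|s| * p%:R < 1 & admissible S].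
Proof. by rewrite /admissible /= -!andbA; do !bool_congr. Qed.

(* The completely multiplicative function supported on the integers with all prime factors in
   [unzip1 S] and taking the value [p * s] at [p] for [(p, s)] in [S]. *)
Fixpoint lift_point S (n : nat) : C :=
  if S is (p, s) :: S' then (s * p%:R) ^+ logn p n * lift_point S' (n`_p^')%N
  else (n == 1%N)%:R.

Lemma lift_point1 S : lift_point S 1 = 1.
Proof. by elim: S => [|[p s] S IH] //=; rewrite logn1 mul1r partn1. Qed.

Lemma lift_pointM S m n : (0 < m)%N -> (0 < n)%N ->
  lift_point S (m * n) = lift_point S m * lift_point S n.
Proof.
elim: S m n => [|[p s] S IH] m n m0 n0 /=; first by rewrite -natrM mulnb muln_eq1.
by rewrite lognM // partnM // exprD IH ?part_gt0 // mulrACA.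
Qed.

Lemma lift_point_eq0 S p n : prime p -> p \notin unzip1 S -> admissible S -> (0 < n)%N ->
  (p %| n)%N -> lift_point S n = 0.
Proof.
move=> pp; elim: S n => [|[q s] S IH] n /=.
  by move=> _ _ n0 pn; case: eqP pn => // ->; rewrite dvdn1 => /eqP p1; rewrite p1 in pp.
rewrite inE negb_or => /andP[pq pS]; rewrite admissible_cons => /and4P[_ pq' _ aS] n0 pn.
rewrite IH ?mulr0 ?part_gt0 //.
move: pn; rewrite -{1}(partnC q n0) Euclid_dvdM // p_part => /orP[|//].
by rewrite Euclid_dvdX // dvdn_prime2 // (negPf pq).
Qed.

Lemma lift_point_cons_free S p s n : ~~ (p %| n)%N -> (0 < n)%N -> prime p ->
  lift_point ((p, s) :: S) n = lift_point S n.
Proof.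
move=> pn n0 pp /=; rewrite lognE pp n0 (negPf pn) mul1r part_pnat_id //.
by rewrite p'natE.
Qed.

Lemma lift_point_cons_mul S p s n : (0 < n)%N -> prime p ->
  lift_point ((p, s) :: S) (p * n) = s * p%:R * lift_point ((p, s) :: S) n.
Proof.
move=> n0 pp; rewrite lift_pointM ?(prime_gt0 pp) //; congr (_ * _) => /=.
rewrite -[X in logn _ X]expn1 pfactorK // expr1 -[RHS]mulr1; congr (_ * _).
suff -> : (p`_p^' = 1)%N by rewrite lift_point1.
by apply/eqP; rewrite partn_eq1 ?prime_gt0 // pnatNK pnat_id.
Qed.

Local Arguments lift_point : simpl never.

(** Separating the multiples of [p] bounds the partial sum [X] by [B + |s p| X], the Euler product
    argument, and [|s p| < 1]. *)
Lemma lift_point_summable S : admissible S -> exists2 B, 0 <= B &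
  forall M, \sum_(1 <= n < M.+1) `|lift_point S n| <= B.
Proof.
elim: S => [|[p s] S IH] adm.
  exists 1 => // M; elim: M => [|M IHM]; first by rewrite big_geq.
  case: M IHM => [|M] IHM; first by rewrite big_nat1 lift_point1 normr1.
  by rewrite big_nat_recr //= normr0 addr0.
move: (adm); rewrite admissible_cons => /and4P[pS pp sp admS].
have p0 := prime_gt0 pp.
have [B B0 HB] := IH admS.
have z1 : `|s * p%:R| < 1 by rewrite normrM normr_nat.
have d0 : 0 < 1 - `|s * p%:R| by rewrite subr_gt0.
exists (B / (1 - `|s * p%:R|)) => [|M]; first by rewrite divr_ge0 // ltW.
rewrite ler_pdivlMr // mulrBr mulr1 lerBlDr.
rewrite [leLHS](bigID (fun n => p %| n)%N) /= addrC lerD //.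
  apply: le_trans (HB M); rewrite big_mkcond !big_nat; apply: ler_sum => n /andP[n0 _].
  by case: ifP => // pn; rewrite lift_point_cons_free.
rewrite sum_multiples // mulr_suml.
apply: (@le_trans _ _ (\sum_(1 <= m < (M %/ p).+1) `|lift_point ((p, s) :: S) m| * `|s * p%:R|)).
  rewrite !big_nat; apply: ler_sum => m /andP[m0 _].
  by rewrite lift_point_cons_mul // normrM mulrC.
rewrite [leRHS](@big_cat_nat _ _ _ (M %/ p).+1) ?ltnS ?leq_div //= lerDl.
by apply: sumr_ge0 => m _; rewrite mulr_ge0.
Qed.

Definition lift_partial S M c : C := \sum_(1 <= n < M.+1) lift_point S n * c n / n%:R.

Lemma eq_lift_partial S M c c' : c =1 c' -> lift_partial S M c = lift_partial S M c'.
Proof. by move=> E; apply: eq_bigr => n _; rewrite E. Qed.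

Lemma peel_bounded S b (B : C) : 0 <= B -> (forall n, `|b n| <= B) ->
  exists2 B', 0 <= B' & forall n, `|peel S b n| <= B'.
Proof.
move=> B0 bB; elim: S => [|[p s] S [B' B'0 IH]]; first by exists B.
exists (B' + `|s| * B') => [|n /=]; first by rewrite addr_ge0 // mulr_ge0.
by apply: le_trans (ler_normB _ _) _; rewrite lerD // normrM ler_wpM2l.
Qed.

Lemma lift_partial_tail S c (B D : C) m M : 0 <= D -> (forall n, `|c n| <= D) ->
  (forall M, \sum_(1 <= n < M.+1) `|lift_point S n| <= B) -> (m <= M)%N ->
  `|lift_partial S M c - lift_partial S m c| <= B * D / m.+1%:R.
Proof.
move=> D0 cD SB mM; rewrite /lift_partial (@big_cat_nat _ _ _ m.+1 1 M.+1) //=.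
rewrite [X in `|X - _|]addrC addrK; apply: le_trans (ler_norm_sum _ _ _) _.
apply: (@le_trans _ _ (\sum_(m.+1 <= n < M.+1) `|lift_point S n| * (D / m.+1%:R))).
  rewrite !big_nat; apply: ler_sum => n /andP[mn _].
  rewrite !normrM normfV normr_nat -mulrA ler_wpM2l // ler_pM ?invr_ge0 //.
  by rewrite lef_pV2 ?posrE ?ltr0n ?ler_nat //; lia.
rewrite -mulr_suml -mulrA ler_wpM2r ?divr_ge0 //.
apply: le_trans (SB M); rewrite [leRHS](@big_cat_nat _ _ _ m.+1) //= lerDr.
by apply: sumr_ge0.
Qed.

(** The factor [1 - s T_p] cancels the Euler factor of the lift point at [p]. For partial sums the
    cancellation is between ranges [M] and [M %/ p], which leaves an error of order [1/M]. *)
Lemma lift_partial_peel S b (B : C) : admissible S -> 0 <= B -> (forall n, `|b n| <= B) ->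
  exists2 D, 0 <= D & forall M, `|lift_partial S M (peel S b) - b 1%N| <= D / M.+1%:R.
Proof.
move=> + B0 bB; elim: S => [|[p s] S IH] adm.
  exists B => // M.
  have -> : lift_partial [::] M (peel [::] b) = if (0 < M)%N then b 1%N else 0.
    rewrite /lift_partial; case: M => [|M] /=; first by rewrite big_geq.
    rewrite big_ltn // lift_point1 mul1r divr1 big_nat big1 ?addr0 // => n /andP[n1 _].
    by rewrite /lift_point gtn_eqF // !mul0r.
  case: ltnP => [_|M0]; first by rewrite subrr normr0 divr_ge0.
  by move: M0; rewrite leqn0 => /eqP ->; rewrite sub0r normrN divr1.
have [B1 B10 HB1] := lift_point_summable adm.
move: (adm); rewrite admissible_cons => /and4P[pS pp sp admS].
have p0 := prime_gt0 pp.
have [D D0 HD] := IH admS; have [B' B'0 HB'] := peel_bounded S B0 bB.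
exists (D + `|s| * (B1 * B') * p%:R) => [|M]; first by rewrite addr_ge0 // !mulr_ge0.
set b' := peel S b in HD HB' *; pose Tb n := b' (p * n)%N.
have E1 : lift_partial ((p, s) :: S) M (peel ((p, s) :: S) b) =
    lift_partial ((p, s) :: S) M b' - s * lift_partial ((p, s) :: S) M Tb.
  rewrite /lift_partial mulr_sumr -sumrB; apply: eq_bigr => n _ /=.
  by rewrite /Tb -/b'; ring.
(* On integers prime to [p] the two lift points agree, and [lift_point S] vanishes on multiples of
   [p]. *)
have E2 : lift_partial ((p, s) :: S) M b' =
    lift_partial S M b' + s * lift_partial ((p, s) :: S) (M %/ p) Tb.
  rewrite /lift_partial (bigID (fun n => p %| n)%N) /= addrC; congr (_ + _).
    rewrite big_mkcond !big_nat; apply: eq_bigr => n /andP[n0 _].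
    case: ifP => [pn|/negbFE pn]; first by have -> := lift_point_cons_free S s pn n0 pp.
    by rewrite (@lift_point_eq0 S p) // !mul0r.
  rewrite sum_multiples // mulr_sumr !big_nat; apply: eq_bigr => m /andP[m0 _].
  have -> := lift_point_cons_mul S s m0 pp; rewrite /Tb natrM.
  have pn0 : p%:R != 0 :> C by rewrite pnatr_eq0 -lt0n.
  have mn0 : m%:R != 0 :> C by rewrite pnatr_eq0 -lt0n.
  by field; rewrite pn0 mn0.
have T := lift_partial_tail B'0 (fun n => HB' (p * n)%N) HB1 (leq_div M p).
have -> : lift_partial ((p, s) :: S) M (peel ((p, s) :: S) b) - b 1%N =
   (lift_partial S M b' - b 1%N) -
   s * (lift_partial ((p, s) :: S) M Tb - lift_partial ((p, s) :: S) (M %/ p) Tb).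
  by rewrite E1 E2; ring.
apply: le_trans (ler_normB _ _) _; rewrite mulrDl lerD // normrM -!mulrA ler_wpM2l //.
apply: le_trans T _; rewrite -!mulrA !ler_wpM2l //.
rewrite ler_pdivlMr ?ltr0n // mulrC ler_pdivrMr ?ltr0n // -natrM ler_nat.
by rewrite mulnC; have := ltn_ceil M p0; lia.
Qed.
End LiftEvaluation.

(** * Cosine sums *)

Section CosineSums.
Variable R : realType.
Implicit Types (x y a : R).

Lemma cos_lipschitz x y : `|cos x - cos y| <= `|x - y|.
Proof.
wlog xy : x y / x <= y.
  move=> W; case/orP: (le_total x y) => ?; first exact: W.
  by rewrite distrC [leRHS]distrC W.
have [c _ E] := MVT_segment xy (fun z _ => is_derive_cos z)
  (continuous_subspaceT (@continuous_cos R)).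
rewrite distrC E normrM normrN [`|x - y|]distrC ler_piMl //.
exact: sin_max.
Qed.

Lemma cosD2piM x (n : nat) : cos (x + 2 * pi * n%:R) = cos x.
Proof.
by rewrite -(periodicn (@cosD2pi R) n x); congr (cos (_ + _)); rewrite -mulr_natl; ring.
Qed.

(** Shifting [t] by one shows that the pair [(A, B)] of cosine and sine sums is fixed by the
    rotation of angle [th], which is not the identity when [k] does not divide [j]. *)
Lemma sum_cos_arith x (j k : nat) : (0 < k)%N ->
  \sum_(0 <= t < k) cos (x + 2 * pi * j%:R * t%:R / k%:R) =
  if (k %| j)%N then k%:R * cos x else 0.
Proof.
move=> k0; have kn0 : k%:R != 0 :> R by rewrite pnatr_eq0 -lt0n.
case: ifPn => [/dvdnP[i ->]|kj].
  under eq_bigr => t _.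
    have -> : x + 2 * pi * (i * k)%:R * t%:R / k%:R = x + 2 * pi * (i * t)%:R.
      by rewrite !natrM; field.
    rewrite cosD2piM; over.
  by rewrite sumr_const_nat subn0 mulr_natl.
pose th : R := 2 * pi * j%:R / k%:R.
have thE t : x + 2 * pi * j%:R * t%:R / k%:R = x + th * t%:R by rewrite /th; field.
under eq_bigr do rewrite thE.
set A := \sum_(0 <= t < k) _; pose B := \sum_(0 <= t < k) sin (x + th * t%:R).
have cosk : cos (x + th * k%:R) = cos (x + th * 0%:R).
  by rewrite -(cosD2piM (x + th * 0%:R) j) /th; congr cos; field.
have sink : sin (x + th * k%:R) = sin (x + th * 0%:R).
  rewrite -!cosBpihalf -(cosD2piM (x + th * 0%:R - pi / 2) j) /th; congr cos; field.
  by rewrite kn0.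
have shift (f : R -> R) : f (x + th * k%:R) = f (x + th * 0%:R) ->
    \sum_(0 <= t < k) f (x + th * t%:R + th) = \sum_(0 <= t < k) f (x + th * t%:R).
  move=> fk; transitivity (\sum_(1 <= t < k.+1) f (x + th * t%:R)).
    by rewrite big_add1 /=; apply: eq_bigr => t _; rewrite -natr1; congr f; ring.
  rewrite big_nat_recr //= [RHS]big_ltn // fk addrC; congr (_ + _).
have eA : A = A * cos th - B * sin th.
  rewrite -[LHS](shift _ cosk) /A /B !mulr_suml -sumrB; apply: eq_bigr => t _; exact: cosD.
have eB : B = B * cos th + A * sin th.
  rewrite -[LHS](shift _ sink) /A /B !mulr_suml -big_split; apply: eq_bigr => t _.
  by rewrite sinD.
have c1 : cos th != 1.
  pose y := pi * (j %% k)%:R / k%:R : R.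
  have -> : cos th = cos (y *+ 2).
    rewrite -(cosD2piM (y *+ 2) (j %/ k)) /y /th; congr cos.
    by rewrite {1}(divn_eq j k) natrD natrM -[_ *+ 2]mulr_natl; field.
  rewrite cos_mulr2n cos2sin2; have s0 : 0 < sin y.
    have jk : (0 < j %% k)%N by rewrite lt0n.
    apply: sin_gt0_pi; rewrite /y divr_gt0 ?mulr_gt0 ?pi_gt0 ?ltr0n //=.
    by rewrite ltr_pdivrMr ?ltr0n // ltr_pM2l ?pi_gt0 // ltr_nat ltn_mod.
  rewrite lt_eqF //; have : 0 < sin y ^+ 2 by rewrite exprn_gt0.
  by rewrite -mulr_natl; lra.
have cs := cos2Dsin2 th.
have : A * (2 * (1 - cos th)) = 0.
  have e1 : A * (1 - cos th) = - (B * sin th) by rewrite mulrBr mulr1 {1}eA; ring.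
  have e2 : B * (1 - cos th) = A * sin th by rewrite mulrBr mulr1 {1}eB; ring.
  have : A * (1 - cos th) * (1 - cos th) = - (A * sin th * sin th).
    by rewrite e1 -e2; ring.
  have -> : A * (2 * (1 - cos th)) = A * (1 - cos th) * (1 - cos th) + A * sin th * sin th
     + A * (1 - (cos th ^+ 2 + sin th ^+ 2)) by ring.
  by move=> ->; rewrite cs; ring.
by move/eqP; rewrite !mulf_eq0 pnatr_eq0 /= subr_eq0 [1 == _]eq_sym (negPf c1) orbF => /eqP.
Qed.

Definition cos_transform (N : nat) (g : nat -> R) (j : nat) : R :=
  \sum_(0 <= r < N) g r * cos (2 * pi * j%:R * r%:R / N%:R).

Lemma cos_transform_periodic N g : (0 < N)%N -> mod_periodic N (cos_transform N g).
Proof.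
move=> N0 m n mn; have Nn0 : N%:R != 0 :> R by rewrite pnatr_eq0 -lt0n.
suff H k : cos_transform N g k = cos_transform N g (k %% N) by rewrite H mn -H.
apply: eq_bigr => r _; congr (_ * _).
rewrite -(cosD2piM (2 * pi * (k %% N)%:R * r%:R / N%:R) (k %/ N * r)); congr cos.
by rewrite {1}(divn_eq k N) natrD !natrM; field.
Qed.

(** Fourier inversion for even sequences: the product of cosines splits into frequencies [r + l] and
    [r - l], orthogonality selects one [r] for each, and evenness makes both terms equal to
    [g l]. *)
Lemma cos_transform_twice N g l : (0 < N)%N -> mod_periodic N g ->
  (forall r, (r <= N)%N -> g (N - r)%N = g r) ->
  \sum_(0 <= j < N) cos_transform N g j * cos (2 * pi * j%:R * l%:R / N%:R) = N%:R * g l.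
Proof.
move=> N0 gN gE; have Nn0 : N%:R != 0 :> R by rewrite pnatr_eq0 -lt0n.
pose l' := (l %% N)%N; have l'N : (l' < N)%N by rewrite ltn_mod.
have gl : g l = g l' by apply: gN; rewrite modn_mod.
have cl j : cos (2 * pi * j%:R * l%:R / N%:R) = cos (2 * pi * j%:R * l'%:R / N%:R) :> R.
  rewrite -(cosD2piM (2 * pi * j%:R * l'%:R / N%:R) (j * (l %/ N))); congr cos.
  by rewrite {1}(divn_eq l N) natrD !natrM; field.
under eq_bigr do rewrite cl /cos_transform mulr_suml.
rewrite exchange_big_nat /=.
have E r : \sum_(0 <= j < N) g r * cos (2 * pi * j%:R * r%:R / N%:R) * cos (2 * pi * j%:R * l'%:R / N%:R)
   = N%:R / 2 * (g r * (N %| r + l')%N%:R + g r * (N %| r + (N - l'))%N%:R).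
  have prod j : cos (2 * pi * j%:R * r%:R / N%:R) * cos (2 * pi * j%:R * l'%:R / N%:R) =
    (cos (0 + 2 * pi * (r + l')%:R * j%:R / N%:R) + cos (0 + 2 * pi * (r + (N - l'))%:R * j%:R / N%:R)) / 2 :> R.
    have -> : cos (0 + 2 * pi * (r + (N - l'))%:R * j%:R / N%:R) =
       cos (2 * pi * j%:R * r%:R / N%:R - 2 * pi * j%:R * l'%:R / N%:R) :> R.
      rewrite -(cosD2piM (2 * pi * j%:R * r%:R / N%:R - 2 * pi * j%:R * l'%:R / N%:R) j); congr cos.
      by rewrite natrD natrB 1?ltnW //; field.
    have -> : 0 + 2 * pi * (r + l')%:R * j%:R / N%:R =
       2 * pi * j%:R * r%:R / N%:R + 2 * pi * j%:R * l'%:R / N%:R :> R by rewrite natrD; field.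
    by rewrite cosD cosB; field.
  under eq_bigr do rewrite -mulrA prod.
  rewrite -mulr_sumr -mulr_suml big_split /= !sum_cos_arith // cos0 !mulr1.
  by case: ifP; case: ifP => _ _; rewrite ?mulr1n ?mulr0n; field.
under eq_bigr do rewrite E.
rewrite -mulr_sumr big_split /=.
have pick s : (s <= N)%N -> \sum_(0 <= r < N) g r * (N %| r + s)%N%:R = g (N - s)%N.
  move=> sN; rewrite big_mkord.
  have rN : ((N - s) %% N < N)%N by rewrite ltn_mod.
  rewrite (bigD1 (Ordinal rN)) //= big1 ?addr0 => [|r rs].
    rewrite (_ : (N %| _)%N) ?mulr1; first by apply: gN; rewrite modn_mod.
    by rewrite /dvdn modnDml subnK // modnn.
  rewrite (_ : (N %| _)%N = false) ?mulr0 //; apply: contra_neqF rs => /dvdnP[q qE].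
  apply/val_inj => /=; have rl := ltn_ord r.
  have [s0|s0] := posnP s.
    move: qE; rewrite s0 addn0 subn0 modnn => qE.
    by case: q qE => [|q] qE; [lia|move: rl; rewrite qE mulSn; lia].
  have q1 : q = 1%N.
    case: q qE => [|[|q]] // qE; first by lia.
    by move: qE; rewrite !mulSn; lia.
  by rewrite modn_small; lia.
rewrite pick ?(ltnW l'N) // pick ?leq_subr // subKn ?(ltnW l'N) // gE ?(ltnW l'N) // gl.
by field.
Qed.

(** Reindex the inversion formula by [j |-> u * j], a permutation mod [N], and move [u] from the
    frequency to the argument. *)
Lemma cos_transform_semicharacter N g u (e : R) : (0 < N)%N -> mod_periodic N g ->
  (forall r, (r <= N)%N -> g (N - r)%N = g r) -> coprime u N -> 
  (forall k, (0 < k)%N -> cos_transform N g (u * k)%N = e * cos_transform N g k) ->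
  forall l, g l = e * g (u * l)%N.
Proof.
move=> N0 gN gE uN ce l; have Nn0 : N%:R != 0 :> R by rewrite pnatr_eq0 -lt0n.
have cN := cos_transform_periodic g N0.
have {}ce k : cos_transform N g (u * k)%N = e * cos_transform N g k.
  (* The case [k = 0] is read off at [k = N]. *)
  have [->|/ce//] := posnP k; have E : (0 = N %[mod N])%N by rewrite modnn mod0n.
  rewrite (cN 0%N N E) -ce // muln0; apply: cN; rewrite mod0n modnMl //.
apply: (mulfI Nn0); rewrite mulrCA -(cos_transform_twice l) // -(cos_transform_twice (u * l)) // mulr_sumr !big_mkord.
have lt (i : nat) : (i %% N < N)%N by rewrite ltn_mod.
pose f (j : 'I_N) : 'I_N := Ordinal (lt (u * j)%N).
rewrite (reindex_inj (h := f)) /=.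
  apply: eq_bigr => j _ /=; rewrite mulrA -ce; congr (_ * _); first by apply: cN; rewrite modn_mod.
  rewrite -(cosD2piM (2 * pi * (u * j %% N)%:R * l%:R / N%:R) ((u * j) %/ N * l)); congr cos.
  have := divn_eq (u * j) N => /(congr1 (fun n => n%:R : R)); rewrite natrD !natrM => E.
  have -> : 2 * pi * j%:R * (u%:R * l%:R) / N%:R = 2 * pi * (u%:R * j%:R) * l%:R / N%:R :> R by ring.
  by rewrite E; field.
move=> j k /(congr1 val) /= jk; apply/val_inj => /=.
exact: coprime_muln_mod_inj uN (ltn_ord j) (ltn_ord k) jk.
Qed.
End CosineSums.

(** * Step functions on a regular grid *)

Section CellCoefficients.
Variable R : realType.
Implicit Types (Q V : nat -> R).

(* Up to the factor [pi * j / 2], the [j]-th sine coefficient of the step function equal to [Q i]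
   on the [i]-th of [L] equal subintervals of (0, 1). *)
Definition cell_coef (L : nat) Q (j : nat) : R :=
  \sum_(0 <= i < L) Q i * (cos (pi * j%:R * i%:R / L%:R) - cos (pi * j%:R * i.+1%:R / L%:R)).

Lemma cell_coef_le L Q j : (0 < L)%N ->
  `|cell_coef L Q j| <= pi * j%:R * (\sum_(0 <= i < L) `|Q i| / L%:R).
Proof.
move=> L0; apply: le_trans (ler_norm_sum _ _ _) _; rewrite mulr_sumr.
apply: ler_sum => i _; rewrite normrM mulrCA ler_wpM2l //.
apply: le_trans (cos_lipschitz _ _) _; rewrite distrC.
have -> : pi * j%:R * i.+1%:R / L%:R - pi * j%:R * i%:R / L%:R = pi * j%:R / L%:R :> R.
  by rewrite -natr1; ring.
by rewrite ger0_norm // divr_ge0 // mulr_ge0 // pi_ge0.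
Qed.

Lemma cell_coef1 L j : (0 < L)%N -> cell_coef L (fun=> 1) j = 2 * (odd j)%:R.
Proof.
move=> L0; have Ln0 : L%:R != 0 :> R by rewrite pnatr_eq0 -lt0n.
rewrite /cell_coef; under eq_bigr do rewrite mul1r -opprB.
rewrite sumrN telescope_sumr // opprB mulr0 mul0r cos0 mulfK //.
have -> : cos (pi * j%:R) = (-1) ^+ j :> R.
  by rewrite mulr_natr -[pi *+ j]add0r (alternatingn (@cosDpi R)) cos0 mulr1.
by rewrite -signr_odd; case: (odd j) => /=; rewrite ?expr1 ?expr0 ?mulr1n ?mulr0n; ring.
Qed.

Lemma cell_coef_refine m d V j : (0 < m)%N -> (0 < d)%N ->
  cell_coef (m * d) (fun i => V (i %/ d)%N) j = cell_coef m V j.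
Proof.
move=> m0 d0; rewrite /cell_coef big_nat_mul; apply: eq_bigr => k _.
have mn0 : m%:R != 0 :> R by rewrite pnatr_eq0 -lt0n.
have dn0 : d%:R != 0 :> R by rewrite pnatr_eq0 -lt0n.
have E (i : nat) : pi * j%:R * (i * d)%:R / (m * d)%:R = pi * j%:R * i%:R / m%:R :> R.
  by rewrite !natrM; field; rewrite mn0 dn0.
pose Co (i : nat) : R := cos (pi * j%:R * i%:R / (m * d)%:R).
have tel : \sum_(k * d <= i < k.+1 * d) (Co i - Co i.+1) = Co (k * d)%N - Co (k.+1 * d)%N.
  under eq_bigr do rewrite -opprB.
  by rewrite sumrN telescope_sumr ?leq_mul2r ?leqnSn ?orbT // opprB.
rewrite -!E -/(Co _) -/(Co _) -tel mulr_sumr !big_nat; apply: eq_bigr => i /andP[ki ik].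
congr (V _ * _); apply/eqP.
by rewrite eqn_leq leq_divRL // ki andbT -ltnS ltn_divLR.
Qed.

Section OddPeriodic.
Variables (h : nat) (V : nat -> R).
Hypothesis h0 : (0 < h)%N.
Let N := (2 * h)%N.
(* [V] lists the values on the cells of an odd 2-periodic function, [h] cells per unit. *)
Hypothesis Vodd : forall m n, (N %| (m + n).+1)%N -> V n = - V m.
(** The jump at the grid point [m / h]; adding [N] before taking the predecessor gives the correct
    left neighbour also at [m = 0]. *)
Let g m := V m - V (m + N).-1.

Let N0 : (0 < N)%N. Proof. by rewrite muln_gt0. Qed.

Lemma odd_cells_periodic : mod_periodic N V.
Proof.
(* [n] is congruent to [-(m + 1)] mod [N], so it is the mirror cell of both [m] and [m']. *)
move=> m m' mm'; pose n := (N.-1 * m.+1)%N.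
have E k : (k = m %[mod N])%N -> (N %| (k + n).+1)%N.
  move=> km; rewrite /dvdn -addnS -modnDml km modnDml addnS -addSn /n.
  by rewrite -mulSn prednK // modnMr.
by apply: oppr_inj; rewrite -(Vodd (E m erefl)) -(Vodd (E m' (esym mm'))).
Qed.

Lemma cell_jumps_periodic : mod_periodic N g.
Proof.
move=> m n mn; rewrite /g (odd_cells_periodic mn); congr (_ - _).
apply: odd_cells_periodic; have N1 : (0 < N)%N := N0.
have pr x : ((x + N).-1 = x + N.-1)%N by lia.
by rewrite !pr -modnDml mn modnDml.
Qed.

Lemma cell_jumps_even r : (r <= N)%N -> g (N - r)%N = g r.
Proof.
move=> rN; have N1 : (0 < N)%N := N0.
rewrite /g (@Vodd (r + N).-1 (N - r)%N); last first.
  by have -> : (((r + N).-1 + (N - r)).+1 = N * 2)%N; [lia|exact: dvdn_mulr].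
rewrite (@Vodd r (N - r + N).-1); last first.
  by have -> : ((r + (N - r + N).-1).+1 = N * 2)%N; [lia|exact: dvdn_mulr].
by rewrite opprK addrC.
Qed.

(** These are the sine coefficients of [phi (k x)]. Oddness extends the sum to a full period,
    summation by parts replaces values by jumps, and summing over the [k] repetitions of the jumps
    leaves only multiples of [k]. *)
Lemma cell_coef_odd k j : (0 < k)%N ->
  2 * cell_coef (h * k) V j = if (k %| j)%N then k%:R * cos_transform N g (j %/ k) else 0.
Proof.
move=> k0; pose P := (k * N)%N; have P0 : (0 < P)%N by rewrite muln_gt0 k0.
have hn0 : h%:R != 0 :> R by rewrite pnatr_eq0 -lt0n.
have kn0 : k%:R != 0 :> R by rewrite pnatr_eq0 -lt0n.
pose Co (m : nat) : R := cos (2 * pi * j%:R * m%:R / P%:R).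
have PE : P%:R = 2 * h%:R * k%:R :> R by rewrite /P /N !natrM; ring.
have cE : cell_coef (h * k) V j = \sum_(0 <= m < h * k) V m * (Co m - Co m.+1).
  apply: eq_bigr => m _; rewrite /Co PE natrM; congr (_ * (cos _ - cos _)); field;
  by rewrite hn0 kn0.
have CoP m : (m <= P)%N -> Co (P - m)%N = Co m.
  move=> mP; rewrite /Co -[RHS]cosN -(cosD2piM (- _) j); congr cos.
  by rewrite natrB // PE; field; rewrite hn0 kn0.
have PhK : P = (h * k + h * k)%N by rewrite /P /N; lia.
have dbl : 2 * cell_coef (h * k) V j = \sum_(0 <= m < P) V m * (Co m - Co m.+1).
  rewrite cE (@big_cat_nat _ _ _ (h * k) 0 P) //=; last by rewrite PhK leq_addr.
  rewrite mulr_natl mulr2n; congr (_ + _).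
  have shift (F : nat -> R) : \sum_(h * k <= m < P) F m = \sum_(0 <= m < h * k) F (m + h * k)%N.
    by rewrite -{1}[(h * k)%N]add0n big_addn PhK addnK.
  rewrite shift [LHS]big_nat_rev /= add0n !big_nat.
  apply: eq_bigr => m /andP[_ mhk].
  have -> : (h * k - m.+1 = P - (m + h * k).+1)%N by lia.
  rewrite (@Vodd (m + h * k) (P - (m + h * k).+1)); last first.
    by have -> : ((m + h * k + (P - (m + h * k).+1)).+1 = P)%N; [lia|exact: dvdn_mull].
  rewrite CoP; last by lia.
  have -> : (P - (m + h * k).+1).+1 = (P - (m + h * k))%N by lia.
  by rewrite CoP ?mulNr -?mulrN ?opprB //; lia.
rewrite dbl; under eq_bigr do rewrite mulrBr.
rewrite sumrB.
(* Summation by parts around a circle: the boundary terms at 0 and [P] coincide. *)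
have -> : \sum_(0 <= m < P) V m * Co m.+1 = \sum_(0 <= m < P) V (m + N).-1 * Co m.
  have VN m : V (m.+1 + N).-1 = V m by apply: odd_cells_periodic; rewrite addSn /= modnDr.
  transitivity (\sum_(1 <= m < P.+1) V (m + N).-1 * Co m).
    by rewrite big_add1 /=; apply: eq_bigr => m _; rewrite VN.
  rewrite big_nat_recr //= [RHS]big_ltn //.
  rewrite addrC; congr (_ * _ + _).
    apply: odd_cells_periodic; have N1 : (0 < N)%N := N0.
    by rewrite (_ : (P + N).-1 = k * N + (0 + N).-1)%N ?modnMDl //; rewrite -/P; lia.
  by rewrite -[in LHS](subn0 P) CoP.
rewrite -sumrB; under eq_bigr do rewrite -mulrBl -/(g _).
have gP t r : g (r + t * N)%N = g r by apply: cell_jumps_periodic; rewrite addnC modnMDl.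
have CoD t r : Co (r + t * N)%N = cos (2 * pi * j%:R * r%:R / P%:R + 2 * pi * j%:R * t%:R / k%:R).
  by rewrite /Co natrD natrM PE /N natrM; congr cos; field; rewrite hn0 kn0.
have -> : \sum_(0 <= m < P) g m * Co m = \sum_(0 <= t < k) \sum_(0 <= r < N)
    g r * cos (2 * pi * j%:R * r%:R / P%:R + 2 * pi * j%:R * t%:R / k%:R).
  rewrite {1}/P big_nat_mul; apply: eq_bigr => t _.
  rewrite -{1}[(t * N)%N]add0n big_addn mulSn addnK; apply: eq_bigr => r _.
  by rewrite gP CoD.
rewrite exchange_big_nat /=.
under eq_bigr do rewrite -mulr_sumr sum_cos_arith //.
case: ifP => kj; last by apply: big1 => r _; rewrite mulr0.
rewrite /cos_transform mulr_sumr; apply: eq_bigr => r _; rewrite mulrCA; congr (_ * (_ * cos _)).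
have := divnK kj => /(congr1 (fun n => n%:R : R)); rewrite natrM => <-.
by rewrite PE /N natrM; field; rewrite hn0 kn0.
Qed.
End OddPeriodic.
End CellCoefficients.

(** Average the pointwise bound [|x| <= x^2 / (2 d) + d / 2]. *)
Lemma sum_abs_le_sum_sq (R : realType) (L : nat) (Q : nat -> R) (d : R) : (0 < L)%N -> 0 < d ->
  \sum_(0 <= i < L) Q i ^+ 2 / L%:R < d ^+ 2 -> \sum_(0 <= i < L) `|Q i| / L%:R <= d.
Proof.
move=> L0 d0 H; have Lp : 0 < L%:R :> R by rewrite ltr0n.
apply: (@le_trans _ _ (\sum_(0 <= i < L) (Q i ^+ 2 / L%:R / (2 * d) + d / 2 / L%:R))).
  apply: ler_sum => i _; rewrite -[_ / L%:R / _]mulrAC -mulrDl ler_pM2r ?invr_gt0 //.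
  have -> : Q i ^+ 2 / (2 * d) + d / 2 = `|Q i| + (`|Q i| - d) ^+ 2 / (2 * d).
    by rewrite -[Q i ^+ 2]real_normK ?num_real //; field; rewrite gt_eqF.
  by rewrite lerDl divr_ge0 ?sqr_ge0 // mulr_ge0 // ltW.
rewrite big_split /= -mulr_suml sumr_const_nat subn0.
have -> : d / 2 / L%:R *+ L = d / 2 by rewrite -mulr_natr divfK // gt_eqF.
have : (\sum_(0 <= i < L) Q i ^+ 2 / L%:R) / (2 * d) <= d ^+ 2 / (2 * d).
  by rewrite ler_pM2r ?invr_gt0 ?mulr_gt0 // ltW.
have -> : d ^+ 2 / (2 * d) = d / 2 by field; rewrite gt_eqF.
lra.
Qed.

(** * From density of the dilations to nonvanishing of the Bohr lift *)

Section CyclicZeroFree.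
Variables (R : realType) (h : nat) (V : nat -> R).
Hypothesis h0 : (0 < h)%N.
Let N := (2 * h)%N.
Hypothesis Vodd : forall m n, (N %| (m + n).+1)%N -> V n = - V m.
Let g m := V m - V (m + N).-1.

(* [fun i => V (i %/ (K`! %/ k))] is the dilation [x |-> phi (k x)] on a grid fine enough for all
   [k < K], so this is the density of the dilations at the constant function 1. *)
Hypothesis V_cyclic : forall eps : R, 0 < eps -> exists (K : nat) (a : nat -> R),
  \sum_(0 <= i < h * K`!)
    (1 - \sum_(1 <= k < K) a k * V (i %/ (K`! %/ k))%N) ^+ 2 / (h * K`!)%:R < eps.

Let c (n : nat) : R[i] := (cos_transform N g n)%:C%C.

Let pairing (S : seq (nat * R[i])) (M L : nat) (Q : nat -> R) : R[i] :=
  \sum_(1 <= j < M.+1) lift_point S j / j%:R * (cell_coef L Q j)%:C%C.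

(** The Lipschitz bound on [cell_coef] supplies a factor [j] that absorbs [1/j], so the functional
    is bounded in the [L^1] norm uniformly in [M]. *)
Let pairing_le S M L Q (B : R[i]) : (0 < L)%N -> 0 <= B ->
  (forall M, \sum_(1 <= n < M.+1) `|lift_point S n| <= B) ->
  `|pairing S M L Q| <= B * (pi * \sum_(0 <= i < L) `|Q i| / L%:R)%:C%C.
Proof.
move=> L0 B0 HB; apply: le_trans (ler_norm_sum _ _ _) _.
set s := \sum_(0 <= i < L) _.
have s0 : 0 <= s by apply: sumr_ge0 => i _; rewrite divr_ge0.
apply: (@le_trans _ _ (\sum_(1 <= j < M.+1) `|lift_point S j| * (pi * s)%:C%C)).
  rewrite !big_nat; apply: ler_sum => j /andP[j0 _].
  rewrite !normrM -mulrA ler_wpM2l // normfV normr_nat.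
  have jp : 0 < j%:R :> R[i] by rewrite ltr0n.
  rewrite mulrC ler_pdivrMr //; have := cell_coef_le Q j L0; rewrite -/s => le.
  have -> : `|(cell_coef L Q j)%:C%C| = (`|cell_coef L Q j|)%:C%C :> R[i].
    by rewrite normc_def /= expr0n addr0 sqrtr_sqr.
  rewrite -(rmorph_nat (real_complex R)) -rmorphM lecR; apply: le_trans le _.
  by rewrite mulrAC.
rewrite -mulr_suml ler_wpM2r // ler0c mulr_ge0 ?pi_ge0 //.
Qed.

Let pairing_linear S M L K (a : nat -> R) (G : nat -> nat -> R) :
  pairing S M L (fun i => 1 - \sum_(1 <= k < K) a k * G k i) =
  pairing S M L (fun=> 1) - \sum_(1 <= k < K) (a k)%:C%C * pairing S M L (G k).
Proof.
have E j : cell_coef L (fun i => 1 - \sum_(1 <= k < K) a k * G k i) j =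
   cell_coef L (fun=> 1) j - \sum_(1 <= k < K) a k * cell_coef L (G k) j.
  pose t i : R := cos (pi * j%:R * i%:R / L%:R) - cos (pi * j%:R * i.+1%:R / L%:R).
  have -> : \sum_(1 <= k < K) a k * cell_coef L (G k) j =
      \sum_(0 <= i < L) \sum_(1 <= k < K) a k * (G k i * t i).
    by rewrite [RHS]exchange_big_nat /=; apply: eq_bigr => k _; rewrite mulr_sumr.
  rewrite /cell_coef -sumrB; apply: eq_bigr => i _; rewrite -/(t i).
  by rewrite mulrBl mulr_suml; congr (_ - _); apply: eq_bigr => k _; rewrite mulrA.
rewrite /pairing; under eq_bigr do rewrite E rmorphB mulrBr.
rewrite sumrB; congr (_ - _); under eq_bigr do rewrite rmorph_sum mulr_sumr.
rewrite exchange_big_nat /=; apply: eq_bigr => k _.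
by rewrite mulr_sumr; apply: eq_bigr => j _; rewrite rmorphM; ring.
Qed.

Let pairing1 S M L : (0 < L)%N ->
  pairing S M L (fun=> 1) = 2 * lift_partial S M (fun n => (odd n)%:R).
Proof.
move=> L0; rewrite /pairing /lift_partial mulr_sumr; apply: eq_bigr => j _.
by rewrite cell_coef1 // rmorphM !rmorph_nat; ring.
Qed.

Let pairing_dilation S M K k : (0 < k < K)%N -> 
  pairing S M (h * K`!) (fun i => V (i %/ (K`! %/ k))%N) =
  lift_point S k / 2 * lift_partial S (M %/ k) c.
Proof.
move=> /andP[k0 kK]; have kF : (k %| K`!)%N by rewrite dvdn_fact // k0 ltnW.
have d0 : (0 < K`! %/ k)%N by rewrite divn_gt0 // dvdn_leq // fact_gt0.
have E j : cell_coef (h * K`!) (fun i => V (i %/ (K`! %/ k))%N) j =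
   if (k %| j)%N then k%:R * cos_transform N g (j %/ k) / 2 else 0.
  have -> : (h * K`! = h * k * (K`! %/ k))%N by rewrite -mulnA [(k * _)%N]mulnC divnK.
  rewrite cell_coef_refine ?muln_gt0 ?h0 // -[LHS](mulKf (_ : 2 != 0 :> R)) // cell_coef_odd //.
  by case: ifP => _; rewrite ?mulr0 // mulrC.
rewrite /pairing; under eq_bigr do rewrite E.
rewrite (bigID (fun j => k %| j)%N) /= addrC big1 ?add0r; last first.
  by move=> j /negPf ->; rewrite rmorph0 mulr0.
under eq_bigr => j kj do rewrite kj.
rewrite sum_multiples // /lift_partial mulr_sumr !big_nat; apply: eq_bigr => m /andP[m0 _].
rewrite lift_pointM // mulKn // natrM !rmorphM fmorphV !rmorph_nat -/(c m).
have kn0 : k%:R != 0 :> R[i] by rewrite pnatr_eq0 -lt0n.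
have mn0 : m%:R != 0 :> R[i] by rewrite pnatr_eq0 -lt0n.
by field; rewrite kn0 mn0.
Qed.

(** The constant function 1 has coefficients proportional to [odd n], an eigenvector of every [T_p].
    Each factor [1 - s T_p] scales it by [1 - s * odd p], nonzero because [|s| < 1], so the lift of
    the constant 1 does not vanish. *)
Let odd_preimage S : admissible S -> exists2 w : R[i], w != 0 &
  peel S (fun n => w * (odd n)%:R) =1 (fun n => (odd n)%:R).
Proof.
elim: S => [|[p s] S IH] adm; first by exists 1; rewrite ?oner_eq0 // => n /=; rewrite mul1r.
move: adm; rewrite admissible_cons => /and4P[_ pp sp /IH[w w0 E]].
pose e : R[i] := 1 - s * (odd p)%:R.
have e0 : e != 0.
  rewrite subr_eq0; apply: contraTneq sp => se; rewrite real_ltNge ?realM //.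
  rewrite negbK; case: (odd p) se => /= se; last by move: se => /eqP; rewrite mulr0 oner_eq0.
  by rewrite mulr1 in se; rewrite -se normr1 mul1r ler1n prime_gt0.
have peelZ (k : R[i]) b n : peel S (fun n => k * b n) n = k * peel S b n.
  elim: (S) n => //= ps S' IH' n; rewrite !IH'; ring.
exists (e^-1 * w) => [|n /=]; first by rewrite mulf_neq0 ?invr_eq0.
have F m : peel S (fun n => e^-1 * w * (odd n)%:R) m = e^-1 * (odd m)%:R.
  rewrite (@eq_peel _ S _ (fun n => e^-1 * (w * (odd n)%:R))) => [|k]; last by rewrite mulrA.
  by rewrite peelZ E.
rewrite -/(peel _ _) !F oddM -mulnb natrM.
have -> : e^-1 * (odd n)%:R - s * (e^-1 * ((odd p)%:R * (odd n)%:R)) = e^-1 * e * (odd n)%:R.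
  by rewrite /e; ring.
by rewrite mulVf // mul1r.
Qed.

(** If [b 1 = 0], the functional tends to 0 on every dilation of [phi] but to [2 w] on the constant
    1. Approximating 1 within [d] in [L^1] gives [2 |w| <= B1 * pi * d] for all [d > 0]. *)
Theorem cyclic_zero_free : zero_free N c.
Proof.
move=> S b adm bN cE; apply/negP => /eqP b1.
have N0 : (0 < N)%N by rewrite muln_gt0.
have [B1 B10 HB1] := lift_point_summable adm.
have bB n : `|b n| <= \sum_(r < N) `|b r|.
  have nN : (n %% N < N)%N by rewrite ltn_mod.
  rewrite (bN n (n %% N)%N) ?modn_mod // (bigD1 (Ordinal nN)) //= lerDl.
  exact: sumr_ge0.
have [D D0 HD] := lift_partial_peel adm (sumr_ge0 _ (fun _ _ => normr_ge0 _)) bB.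
have [w w0 Ew] := odd_preimage adm.
have wB n : `|w * (odd n)%:R| <= `|w|.
  by rewrite normrM normr_nat ler_piMr // lern1 leq_b1.
have [D' D'0 HD'] := lift_partial_peel adm (normr_ge0 w) wB.
have {}HD M : `|lift_partial S M c| <= D / M.+1%:R.
  by have := HD M; rewrite b1 subr0 -(eq_lift_partial S M cE).
have {}HD' M : `|lift_partial S M (fun n => (odd n)%:R) - w| <= D' / M.+1%:R.
  by have := HD' M; rewrite mulr1 (eq_lift_partial S M Ew).
have main (d : R) : 0 < d -> 2 * `|w| <= B1 * (pi * d)%:C%C.
  move=> d0; have [K [a Ha]] := V_cyclic (exprn_gt0 2 d0).
  have L0 : (0 < h * K`!)%N by rewrite muln_gt0 h0 fact_gt0.
  set Q := fun i => 1 - \sum_(1 <= k < K) a k * V (i %/ (K`! %/ k))%N.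
  pose W := 2 * D' + \sum_(1 <= k < K) `|(a k)%:C%C * (lift_point S k / 2)| * D.
  have W0 : 0 <= W by rewrite addr_ge0 ?mulr_ge0 // sumr_ge0 // => k _; rewrite mulr_ge0.
  have bound T : 2 * `|w| <= B1 * (pi * d)%:C%C + W / T.+1%:R.
    (* All truncations [M %/ k] with [0 < k < K] are then at least [T], so every error term is of
       order [1/T]. *)
    pose M := (K`! * T)%N.
    have TM k : (0 < k < K)%N -> (T <= M %/ k)%N.
      move=> /andP[k0 kK]; rewrite leq_divRL // mulnC leq_mul2r.
      by rewrite dvdn_leq ?orbT ?fact_gt0 // dvdn_fact // k0 ltnW.
    have TM1 : (T <= M)%N by rewrite leq_pmull // fact_gt0.
    have inv m : (T <= m)%N -> m.+1%:R^-1 <= T.+1%:R^-1 :> R[i].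
      by move=> Tm; rewrite lef_pV2 ?posrE ?ltr0n // ler_nat ltnS.
    have := pairing_linear S M (h * K`!) K a (fun k i => V (i %/ (K`! %/ k))%N).
    rewrite pairing1 // -/Q => E.
    have -> : 2 * `|w| = `|pairing S M (h * K`!) Q -
        2 * (lift_partial S M (fun n => (odd n)%:R) - w) +
        \sum_(1 <= k < K) (a k)%:C%C * pairing S M (h * K`!) (fun i => V (i %/ (K`! %/ k))%N)|.
      rewrite -[2 in LHS]normr_nat -normrM E; congr `|_|; ring.
    apply: le_trans (ler_normD _ _) _; apply: le_trans (lerD (ler_normB _ _) (lexx _)) _.
    rewrite -[leLHS]addrA lerD //.
      apply: le_trans (pairing_le M Q L0 B10 HB1) _; rewrite ler_wpM2l // lecR.
      by rewrite ler_wpM2l ?pi_ge0 //; apply: sum_abs_le_sum_sq.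
    rewrite /W [leRHS]mulrDl; apply: lerD.
      rewrite normrM normr_nat -mulrA ler_wpM2l //; apply: le_trans (HD' M) _.
      by rewrite ler_wpM2l // inv.
    apply: le_trans (ler_norm_sum _ _ _) _; rewrite mulr_suml !big_nat.
    apply: ler_sum => k kK; rewrite pairing_dilation // mulrA normrM -mulrA ler_wpM2l //.
    by apply: le_trans (HD _) _; rewrite ler_wpM2l // inv // TM.
  have /complex_realP[w1 w1E] : 2 * `|w| \is Num.real by rewrite realM ?normr_real ?realn.
  have /complex_realP[W1 W1E] : W \is Num.real by rewrite ger0_real.
  have /complex_realP[B2 B2E] : B1 \is Num.real by rewrite ger0_real.
  rewrite w1E B2E -rmorphM lecR; apply/ler_addgt0Pr => e e0.
  have W10 : 0 <= W1 by rewrite -ler0c -W1E.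
  have := bound (Num.truncn (W1 / e)).
  rewrite w1E B2E W1E -rmorphM -(rmorph_nat (real_complex R)) -fmorphV -rmorphM -rmorphD lecR.
  move=> /le_trans; apply; rewrite lerD2l ler_pdivrMr ?ltr0n // mulrC -ler_pdivrMr //.
  by rewrite ltW // truncnS_gt.
have /complex_realP[w1 w1E] : 2 * `|w| \is Num.real by rewrite realM ?normr_real ?realn.
have /complex_realP[B2 B2E] : B1 \is Num.real by rewrite ger0_real.
have w1p : 0 < w1 by rewrite -ltcR rmorph0 -w1E mulr_gt0 // normr_gt0.
have B2p : 0 <= B2 by rewrite -ler0c -B2E.
have p0 : 0 < pi :> R by exact: pi_gt0.
have q0 : 0 < B2 + 1 by rewrite ltr_wpDl.
have k0 : 0 < (B2 + 1) * pi by rewrite mulr_gt0.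
(* This [d] makes the right-hand side at most [w1 / 2]; [B2 + 1] is used because [B2] may be 0. *)
have := main (w1 / 2 / ((B2 + 1) * pi)) (divr_gt0 (divr_gt0 w1p _) k0).
rewrite w1E B2E -rmorphM lecR => /(_ (ltr0n _ _)).
have -> : B2 * (pi * (w1 / 2 / ((B2 + 1) * pi))) = w1 / 2 * (B2 / (B2 + 1)).
  have gen x y : x != 0 -> y != 0 -> B2 * (x * (w1 / 2 / (y * x))) = w1 / 2 * (B2 / y).
    by move=> x0 y0; field; rewrite x0 y0.
  by rewrite gen ?gt_eqF.
have : B2 / (B2 + 1) <= 1 by rewrite ler_pdivrMr // mul1r lerDl.
nra.
Qed.
End CyclicZeroFree.

(** * Jumps of step functions *)

Section StepFunctionJumps.
Variable R : realType.
Implicit Types (phi : R -> R) (s : seq R).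

Lemma gap_right s (a y : R) : a < y -> exists y',
  [/\ a < y', y' <= y & forall b, b \in s -> ~~ (a < b < y')].
Proof.
move=> ay; elim: s => [|b s [y' [ay' y'y H]]]; first by exists y.
have [ab|ba] := ltP a b; last first.
  exists y'; split=> // x; rewrite inE => /orP[/eqP->|/H//]; by rewrite ltNge ba.
exists (Num.min b y'); split; first by rewrite lt_min ab.
  by rewrite ge_min y'y orbT.
move=> x; rewrite inE lt_min => /orP[/eqP->|/H]; first by rewrite ltxx /= andbF.
by apply: contra => /and3P[-> _ ->].
Qed.

Lemma gap_left s (a y : R) : y < a -> exists y',
  [/\ y' < a, y <= y' & forall b, b \in s -> ~~ (y' < b < a)].
Proof.
move=> ya; have [|y' [ay' y'y H]] := @gap_right [seq - b | b <- s] (- a) (- y).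
  by rewrite ltrN2.
exists (- y'); split; rewrite 1?ltrNl 1?lerNr //.
move=> b bs; have /H := map_f -%R bs; apply: contra => /andP[yb ba].
by rewrite ltrN2 ba ltrNl yb.
Qed.

Lemma oddextE phi x : 0 < x < 1 -> oddext phi x = phi x.
Proof.
move=> /andP[x0 x1]; rewrite /oddext.
have -> : Num.floor (x / 2) = 0.
  by apply: floor_def; rewrite add0r; apply/andP; split; lra.
by rewrite mulr0 subr0 x0 x1.
Qed.

Lemma oddext_lim_right phi s (a y v : R) : 0 <= a -> a < y -> y <= 1 ->
  (forall x, a < x < y -> x \notin s -> phi x = v) ->
  lim (oddext phi t @[t --> a^'+]) = v.
Proof.
move=> a0 ay y1 H; have [y' [ay' y'y Hs]] := gap_right s ay.
apply/cvg_lim => //; apply: cvg_near_cst; near=> t.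
have at0 : a < t by near: t; exact: nbhs_right_gt.
have ty : t < y' by near: t; exact: nbhs_right_lt.
rewrite oddextE; last by rewrite (le_lt_trans a0 at0) (lt_le_trans ty) // (le_trans y'y).
apply: H; first by rewrite at0 (lt_le_trans ty).
by apply/negP => /Hs; rewrite at0 ty.
Unshelve. all: by end_near. Qed.

Lemma oddext_lim_left phi s (a y v : R) : 0 <= y -> y < a -> a <= 1 ->
  (forall x, y < x < a -> x \notin s -> phi x = v) ->
  lim (oddext phi t @[t --> a^'-]) = v.
Proof.
move=> y0 ya a1 H; have [y' [ay' y'y Hs]] := gap_left s ya.
apply/cvg_lim => //; apply: cvg_near_cst; near=> t.
have at0 : t < a by near: t; exact: nbhs_left_lt.
have ty : y' < t by near: t; exact: nbhs_left_gt.
rewrite oddextE; last by rewrite (le_lt_trans _ ty) ?(lt_le_trans at0) // (le_trans y0).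
apply: H; first by rewrite at0 (le_lt_trans y'y).
by apply/negP => /Hs; rewrite at0 ty.
Unshelve. all: by end_near. Qed.

(** At a breakpoint [a] between [x] and [y] the one-sided limits are nearby values of [phi], equal
    as the jump vanishes; recursion on either side of [a] then has fewer breakpoints. *)
Lemma step_eq_no_jump phi s : (forall a, a \in s -> a \in @I01 R) ->
  (forall x y, x \in @I01 R -> y \in @I01 R ->
    (forall a, a \in s -> ~ (Num.min x y <= a <= Num.max x y)) -> phi x = phi y) ->
  forall x y, x \in @I01 R -> y \in @I01 R -> x <= y -> x \notin s -> y \notin s ->
  (forall a, a \in s -> x < a < y -> jump phi a = 0) -> phi x = phi y.
Proof.
move=> sI step x y xI yI xy xs ys nj.
have I01E z : (z \in @I01 R) = (0 < z < 1) by apply/idP/idP; rewrite inE /I01 /= in_itv.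
(* The list [t] covers the breakpoints strictly between [x] and [y]; its length is the induction
   measure. *)
have [t st] : exists t : seq R, forall b, b \in s -> x < b < y -> b \in t by exists s.
move: {2}(size t) (leqnn (size t)) => n.
elim: n t x y xI yI xy xs ys nj st => [|n IH] t x y xI yI xy xs ys nj st szt;
  have [/hasP[a as_ xay]|/hasPn no] := boolP (has (fun a => x < a < y) s); last 1 first.
- apply: step => // a as_; rewrite (min_idPl xy) (max_idPr xy) => /andP[xa ay].
  move: (no a as_); rewrite !lt_neqAle xa ay !andbT negb_and !negbK.
  by case/orP => /eqP e; [move: xs; rewrite e as_|move: ys; rewrite -e as_].
- by have := st a as_ xay; move: szt; rewrite leqn0 size_eq0 => /eqP ->.
- apply: step => // a as_; rewrite (min_idPl xy) (max_idPr xy) => /andP[xa ay].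
  move: (no a as_); rewrite !lt_neqAle xa ay !andbT negb_and !negbK.
  by case/orP => /eqP e; [move: xs; rewrite e as_|move: ys; rewrite -e as_].
have /andP[xa ay] := xay.
have [r [ar ry Hr]] := gap_right s ay; have [l [la xl Hl]] := gap_left s xa.
have /andP[x0 x1] : 0 < x < 1 by rewrite -I01E.
have /andP[y0 y1] : 0 < y < 1 by rewrite -I01E.
pose r' := (a + r) / 2; pose l' := (l + a) / 2.
have [ar' rr'] : a < r' /\ r' < r by rewrite /r'; split; lra.
have [ll' la'] : l < l' /\ l' < a by rewrite /l'; split; lra.
have r's : r' \notin s by apply/negP => /Hr; rewrite ar' rr'.
have l's : l' \notin s by apply/negP => /Hl; rewrite ll' la'.
have r'I : r' \in @I01 R by rewrite I01E; apply/andP; split; lra.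
have l'I : l' \in @I01 R by rewrite I01E; apply/andP; split; lra.
pose t' := [seq b <- t | b != a].
have szt' : (size t' <= n)%N.
  rewrite -ltnS; apply: leq_trans szt; rewrite /t' size_filter -(count_predC (pred1 a) t) addnC.
  by rewrite -addn1 leq_add2l -has_count has_pred1 st.
have -> : phi x = phi l'.
  apply: (IH t') => // [|b bs /andP[xb bl]|b bs /andP[xb bl]]; first lra.
    by apply: nj => //; rewrite xb; lra.
  by rewrite mem_filter st ?xb // ?andbT; [rewrite lt_eqF //; lra|lra].
have <- : phi r' = phi y.
  apply: (IH t') => // [|b bs /andP[xb bl]|b bs /andP[xb bl]]; first lra.
    by apply: nj => //; rewrite bl andbT; lra.
  by rewrite mem_filter st ?bl // ?andbT; [rewrite gt_eqF //; lra|lra].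
have jl : lim (oddext phi t @[t --> a^'-]) = phi l'.
  apply: (@oddext_lim_left _ s _ l) => [|//||z /andP[lz za] zs]; [lra|lra|].
  apply: step => // [|b bs]; first by rewrite I01E; apply/andP; split; lra.
  move=> /andP; rewrite ge_min le_max => -[/orP mz /orP Mz].
  have /negP[] := Hl b bs; apply/andP; split; lra.
have jr : lim (oddext phi t @[t --> a^'+]) = phi r'.
  apply: (@oddext_lim_right _ s _ r) => [|//||z /andP[lz za] zs]; [lra|lra|].
  apply: step => // [|b bs]; first by rewrite I01E; apply/andP; split; lra.
  move=> /andP; rewrite ge_min le_max => -[/orP mz /orP Mz].
  have /negP[] := Hr b bs; apply/andP; split; lra.
have := nj a as_ xay; rewrite /jump jl jr => /eqP; rewrite subr_eq0 => /eqP.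
by move=> ->.
Qed.

Lemma cell_avoid s (a b : R) : a < b -> exists2 x, a < x < b & x \notin s.
Proof.
move=> ab; have [y [ay yb H]] := gap_right s ab.
exists ((a + y) / 2); first by apply/andP; split; lra.
by apply/negP => /H/negP[]; apply/andP; split; lra.
Qed.

(* [s] also contains the irrational points where the step function has a removable
   discontinuity, which need not lie on the grid. *)
Definition cell_values phi s h (v : nat -> R) :=
  forall m x, (m < h)%N -> m%:R / h%:R < x < m.+1%:R / h%:R -> x \notin s -> phi x = v m.

Lemma step_cell_values phi : inSr phi -> exists h0 s, (0 < h0)%N /\
  forall h, (0 < h)%N -> (h0 %| h)%N -> exists v, cell_values phi s h v.
Proof.
move=> [[s [sI step]] rat].
have I01E z : (z \in @I01 R) = (0 < z < 1) by apply/idP/idP; rewrite inE /I01 /= in_itv.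
(* [h0] is a common denominator of the breakpoints with nonzero jump, so none of them lies inside a
   cell of a grid refining [1/h0]. *)
have [h0 h00 Hh0] : exists2 h0, (0 < h0)%N & forall a, a \in s -> jump phi a != 0 ->
    exists k : int, a * h0%:R = k%:~R.
  have [f Hf] : exists f : R -> nat, forall a, (0 < f a)%N /\ (a \in s -> jump phi a != 0 ->
      exists k : int, a * (f a)%:R = k%:~R).
    suff /boolp.choice[f Hf] : forall a, exists n : nat, (0 < n)%N /\ (a \in s -> jump phi a != 0 ->
      exists k : int, a * n%:R = k%:~R) by exists f.
    move=> a; have [[as_ ja]|no] := pselect (a \in s /\ jump phi a != 0); last first.
      by exists 1%N; split=> // as_ ja; case: no.
    have [q aq] := rat a (sI a as_) ja; exists `|denq q|%N; split; first by rewrite absz_gt0 denq_neq0.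
    move=> _ _; exists (numq q); rewrite aq /ratr.
    rewrite -[(`|denq q|%N)%:R]/((`|denq q|%N : int)%:~R) absz_denq divfK //.
    by rewrite intr_eq0 denq_neq0.
  exists (\prod_(a <- s) f a)%N.
    by rewrite big_seq; apply: prodn_cond_gt0 => a _; case: (Hf a).
  move=> a as_ ja; have [_ /(_ as_ ja)[k ak]] := Hf a.
  have : (f a %| \prod_(a <- s) f a)%N by rewrite (big_rem a) //= dvdn_mulr.
  move=> /dvdnP[c ->]; exists (k * c%:Z).
  by rewrite natrM mulrCA ak intrM mulrC.
exists h0, s; split=> // h hp /dvdnP[c hc].
have hp0 : 0 < h%:R :> R by rewrite ltr0n.
suff /boolp.choice[v Hv] : forall m, exists w, forall x, (m < h)%N ->
    m%:R / h%:R < x < m.+1%:R / h%:R -> x \notin s -> phi x = w.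
  by exists v => m x mh xc xs; apply: (Hv m x).
move=> m; have [mh|] := ltnP m h; last by exists 0.
have mm : m%:R / h%:R < m.+1%:R / h%:R :> R by rewrite ltr_pM2r ?invr_gt0 // ltr_nat.
have [z zc zs] := cell_avoid s mm; exists (phi z) => x _ xc xs.
have cI y : m%:R / h%:R < y < m.+1%:R / h%:R -> y \in @I01 R.
  move=> /andP[my ym]; rewrite I01E (le_lt_trans _ my) ?divr_ge0 //=.
  by apply: lt_le_trans ym _; rewrite ler_pdivrMr // mul1r ler_nat.
have nj a : a \in s -> m%:R / h%:R < a < m.+1%:R / h%:R -> jump phi a = 0.
  move=> as_ /andP[ma am]; apply/eqP; apply: contraT => /(Hh0 a as_)[k ak].
  have : a * h%:R = (k * c%:Z)%:~R by rewrite hc natrM mulrCA ak intrM mulrC.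
  move: ma am; rewrite ltr_pdivrMr // ltr_pdivlMr // => + + e.
  rewrite e -[m%:R]/((m : int)%:~R) -[m.+1%:R]/((m.+1 : int)%:~R) !ltr_int.
  by lia.
have key x1 x2 : m%:R / h%:R < x1 < m.+1%:R / h%:R -> m%:R / h%:R < x2 < m.+1%:R / h%:R ->
    x1 <= x2 -> x1 \notin s -> x2 \notin s -> phi x1 = phi x2.
  move=> c1 c2 x12 s1 s2; apply: (step_eq_no_jump sI step) => //; try exact: cI.
  move=> a as_ /andP[xa ax]; apply: nj => //.
  move: c1 c2 => /andP[? _] /andP[_ ?]; apply/andP; split; lra.
by case/orP: (le_total x z) => ?; [|apply/esym]; apply: key.
Qed.

Lemma cell_values_jump phi s h v m : (0 < m < h)%N -> cell_values phi s h v ->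
  jump phi (m%:R / h%:R) = v m - v m.-1.
Proof.
move=> /andP[m0 mh] Hv; have hp : 0 < h%:R :> R by rewrite ltr0n (leq_trans _ mh).
rewrite /jump; congr (_ - _).
  apply: (@oddext_lim_right _ s _ (m.+1%:R / h%:R)) => [|||x xc xs]; last exact: Hv.
  - by rewrite divr_ge0.
  - by rewrite ltr_pM2r ?invr_gt0 // ltr_nat.
  - by rewrite ler_pdivrMr // mul1r ler_nat.
apply: (@oddext_lim_left _ s _ (m.-1%:R / h%:R)) => [|||x xc xs].
- by rewrite divr_ge0.
- by rewrite ltr_pM2r ?invr_gt0 // ltr_nat prednK.
- by rewrite ler_pdivrMr // mul1r ler_nat ltnW.
apply: Hv xs; last by rewrite prednK.
exact: leq_ltn_trans (leq_pred m) mh.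
Qed.

Lemma cell_values_jump_grid phi s h v x : (0 < h)%N -> cell_values phi s h v ->
  0 < x < 1 -> jump phi x != 0 -> exists m, (0 < m < h)%N /\ x = m%:R / h%:R.
Proof.
move=> h0 Hv /andP[x0 x1] jx; have hp : 0 < h%:R :> R by rewrite ltr0n.
pose m := Num.truncn (x * h%:R).
have xh0 : 0 <= x * h%:R by rewrite mulr_ge0 // ltW.
have /andP[mx xm] := truncn_itv xh0; rewrite -/m in mx xm.
have mh : (m < h)%N.
  by rewrite -(ltr_nat R); apply: le_lt_trans mx _; rewrite gtr_pMl.
have xm' : x < m.+1%:R / h%:R by rewrite ltr_pdivlMr.
have [e|ne] := eqVneq x (m%:R / h%:R).
  exists m; split=> //; rewrite mh andbT lt0n; apply: contraTneq x0 => m0.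
  by rewrite e m0 mul0r ltxx.
have mx' : m%:R / h%:R < x by rewrite lt_neqAle eq_sym ne ler_pdivrMr.
case/eqP: jx; rewrite /jump; apply/eqP; rewrite subr_eq0; apply/eqP.
have y1 : m.+1%:R / h%:R <= 1 :> R by rewrite ler_pdivrMr // mul1r ler_nat.
have y0 : 0 <= m%:R / h%:R :> R by rewrite divr_ge0.
rewrite (@oddext_lim_right _ s _ (m.+1%:R / h%:R) (v m)) ?(ltW x0) //.
  rewrite (@oddext_lim_left _ s _ (m%:R / h%:R) (v m)) ?(ltW x1) // => z /andP[mz zx] zs.
  by apply: Hv => //; rewrite mz (lt_trans zx).
by move=> z /andP[mz zx] zs; apply: Hv => //; rewrite zx (lt_trans mx').
Qed.
End StepFunctionJumps.

(** Compares the suprema over simple functions that define the two integrals. *)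
Lemma integral_le_nonneg d (T : measurableType d) (R : realType) (mu : {measure set T -> \bar R})
    (D : set T) (f g : T -> \bar R) : (forall x, 0 <= f x)%E ->
  (forall x, D x -> f x <= g x)%E -> (\int[mu]_(x in D) f x <= \int[mu]_(x in D) g x)%E.
Proof.
move=> f0 fg; rewrite integral_mkcond [leRHS]integral_mkcond.
rewrite !ge0_integralTE; last 2 first.
- by move=> x; rewrite patchE; case: ifP => // /set_mem Dx; apply: le_trans (fg x Dx).
- by move=> x; rewrite patchE; case: ifP.
apply: ereal_sup_le => _ /= [k kf <-]; exists k => // x; apply: le_trans (kf x) _.
by rewrite !patchE; case: ifP => // /set_mem; apply: fg.
Qed.

Lemma measurable_seq (R : realType) (s : seq R) : measurable [set` s].
Proof.
elim: s => [|x s IH].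
  by rewrite (_ : [set` _] = set0) // -subset0.
rewrite (_ : [set` _] = [set x] `|` [set` s]); first exact: measurableU.
apply/seteqP; split=> [y /=|y [->|ys] /=]; rewrite inE ?eqxx ?ys ?orbT //.
by case/orP => [/eqP->|ys]; [left|right].
Qed.

(** * Cells of the odd extension and the discretised density condition *)

Section OddCells.
Variable R : realType.
Implicit Types (phi : R -> R) (v : nat -> R).

Definition odd_cells h v (m : nat) : R :=
  let r := (m %% (2 * h))%N in if (r < h)%N then v r else - v (2 * h - r.+1)%N.

Lemma odd_cells_odd h v m n : (0 < h)%N -> (2 * h %| (m + n).+1)%N ->
  odd_cells h v n = - odd_cells h v m.
Proof.
move=> h0 mn; rewrite /odd_cells.
have N0 : (0 < 2 * h)%N by rewrite muln_gt0.
have : ((m %% (2 * h) + n %% (2 * h)).+1 = 2 * h)%N.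
  have e : ((m + n).+1 = (m %/ (2 * h) + n %/ (2 * h)) * (2 * h) +
      (m %% (2 * h) + n %% (2 * h)).+1)%N.
    by rewrite {1}(divn_eq m (2 * h)) {1}(divn_eq n (2 * h)) mulnDl; lia.
  move: mn; rewrite e dvdn_addr; last exact: dvdn_mull (dvdnn _).
  move=> /dvdnP[q qE].
  have := ltn_pmod m N0; have := ltn_pmod n N0; case: q qE => [|[|q]] qE ? ?; first by lia.
    by lia.
  by move: qE; rewrite !mulSn; lia.
move: (m %% _)%N (n %% _)%N => r r' rr.
have [rh|hr] := ltnP r h.
  have -> : (r' < h)%N = false by lia.
  by congr (- v _); lia.
have -> : (r' < h)%N by lia.
by rewrite opprK; congr (v _); lia.
Qed.

(** [y] is [x] reduced to one period; [phi] is evaluated at [y] or, by reflection, at [2 - y], and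
    both must avoid [s]. *)
Lemma oddext_cell phi s h v m x : (0 < h)%N -> cell_values phi s h v ->
  m%:R / h%:R < x < m.+1%:R / h%:R ->
  let y := x - 2 * (m %/ (2 * h))%:R in y \notin s -> 2 - y \notin s ->
  oddext phi x = odd_cells h v m.
Proof.
move=> h0 Hv /andP[mx xm] y ys ys'; have hp : 0 < h%:R :> R by rewrite ltr0n.
have N0 : (0 < 2 * h)%N by rewrite muln_gt0.
set q := (m %/ (2 * h))%N in y ys ys'; set r := (m %% (2 * h))%N.
have mE : m = (q * (2 * h) + r)%N by rewrite -divn_eq.
have rN : (r < 2 * h)%N by rewrite ltn_mod.
move: mx xm; rewrite ltr_pdivrMr // ltr_pdivlMr // => mx xm.
have yh : y * h%:R = x * h%:R - 2 * q%:R * h%:R by rewrite /y; ring.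
have mR : m%:R = 2 * q%:R * h%:R + r%:R :> R by rewrite {1}mE natrD !natrM; ring.
have ry : r%:R < y * h%:R by rewrite yh; lra.
have yr : y * h%:R < r.+1%:R by move: xm; rewrite yh -!natr1 mR; lra.
have y0 : 0 < y by rewrite -(pmulr_lgt0 _ hp); apply: le_lt_trans ry.
have y2 : y < 2.
  rewrite -(ltr_pM2r hp); apply: lt_le_trans yr _.
  by rewrite -natrM ler_nat.
have fl : Num.floor (x / 2) = q%:Z.
  apply: floor_def; rewrite intrD -!pmulrn /y in y0 y2 *; apply/andP; split; lra.
rewrite /oddext fl -pmulrn -/y /odd_cells -/r.
have [rh|hr] := ltnP r h.
  have y1 : y < 1.
    by rewrite -(ltr_pM2r hp) mul1r; apply: lt_le_trans yr _; rewrite ler_nat.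
  rewrite y0 y1 /=; apply: (Hv r) => //.
  by rewrite ltr_pdivrMr // ltr_pdivlMr // ry.
have y1 : 1 < y.
  by rewrite -(ltr_pM2r hp) mul1r; apply: le_lt_trans ry; rewrite ler_nat.
have -> : (0 < y) && (y < 1) = false by rewrite [y < 1]ltNge (ltW y1) andbF.
rewrite y1 y2 /=; congr (- _); apply: Hv => //; first by lia.
rewrite ltr_pdivrMr // ltr_pdivlMr // mulrBl.
have -> : (2 * h - r.+1).+1%:R = 2 * h%:R - r%:R :> R.
  by rewrite subnSK // natrB ?(ltnW rN) // natrM.
rewrite natrB // natrM; apply/andP; split; lra.
Qed.

(** Density is applied to the constant function 1. On the grid of step [1 / (h * K!)] every dilation
    with [k < K] is constant on each cell up to finitely many points, so the integral dominates the
    finite sum. *)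
Lemma cyclic_cells phi s h v : (0 < h)%N -> cell_values phi s h v -> inC phi ->
  forall eps : R, 0 < eps -> exists (K : nat) (a : nat -> R),
  \sum_(0 <= i < h * K`!)
    (1 - \sum_(1 <= k < K) a k * odd_cells h v (i %/ (K`! %/ k))%N) ^+ 2 / (h * K`!)%:R < eps.
Proof.
move=> h0 Hv [_ dense] eps eps0.
have L2_1 : L2 (cst (1 : R)).
  split; first exact: measurable_cst.
  under eq_integral do rewrite expr1n.
  rewrite integral_cst //= ?mul1e ?lebesgue_measure_itv /=; last exact: measurable_itv.
  by rewrite lte_fin ltr01 -EFinB ltry.
have [K [a Ha]] := dense _ L2_1 eps eps0; exists K, a.
set L := (h * K`!)%N; have L0 : (0 < L)%N by rewrite muln_gt0 h0 fact_gt0.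
have Lp : 0 < L%:R :> R by rewrite ltr0n.
set Q := fun i => 1 - \sum_(1 <= k < K) a k * odd_cells h v (i %/ (K`! %/ k))%N.
pose F x := 1 - \sum_(1 <= k < K) a k * oddext phi (k%:R * x).
pose q i k := (i %/ (K`! %/ k) %/ (2 * h))%N.
(* The points [x] for which [k x], translated by the period or then reflected, hits a point of
   [s]. *)
pose E i : seq R := flatten [seq [seq (2 * (q i k)%:R + b) / k%:R | b <- s] ++
                         [seq (2 * (q i k)%:R + (2 - b)) / k%:R | b <- s] | k <- iota 1 K].
pose cell i : set R := `]i%:R / L%:R, i.+1%:R / L%:R[%classic.
pose A i := cell i `\` [set` E i].
have mA i : measurable (A i) by apply: measurableD; [exact: measurable_itv|exact: measurable_seq].
have FQ i x : A i x -> F x = Q i.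
  rewrite /A /cell => -[/=]; rewrite in_itv /= => /andP[ix xi] xE.
  rewrite /F /Q; congr (_ - _); rewrite !big_nat; apply: eq_bigr => k /andP[k1 kK].
  have kp : 0 < k%:R :> R by rewrite ltr0n.
  have kF : (k %| K`!)%N by rewrite dvdn_fact // k1 ltnW.
  have d0 : (0 < K`! %/ k)%N by rewrite divn_gt0 // dvdn_leq // fact_gt0.
  congr (_ * _); set m := (i %/ (K`! %/ k))%N.
  have dp : 0 < (K`! %/ k)%:R :> R by rewrite ltr0n.
  have hp : 0 < h%:R :> R by rewrite ltr0n.
  have LE : L%:R = h%:R * k%:R * (K`! %/ k)%:R :> R.
    by rewrite -!natrM -mulnA [(k * _)%N]mulnC divnK.
  have im : m%:R * (K`! %/ k)%:R <= i%:R :> R by rewrite -natrM ler_nat leq_divM.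
  have mi : i.+1%:R <= m.+1%:R * (K`! %/ k)%:R :> R by rewrite -natrM ler_nat ltn_ceil.
  move: ix xi; rewrite ltr_pdivrMr // ltr_pdivlMr // LE => ix xi.
  apply: (@oddext_cell phi s) => //.
  - have e : k%:R * x * h%:R * (K`! %/ k)%:R = x * (h%:R * k%:R * (K`! %/ k)%:R) by ring.
    rewrite ltr_pdivrMr // ltr_pdivlMr // -(ltr_pM2r dp) -(ltr_pM2r dp (k%:R * x * h%:R)) e.
    by rewrite (le_lt_trans im ix) (lt_le_trans xi mi).
  - apply/negP => bs; apply: xE => /=; apply/flatten_mapP; exists k.
      by rewrite mem_iota k1 add1n ltnW.
    rewrite mem_cat; apply/orP; left; apply/mapP; eexists; first exact: bs.
    by rewrite -/(q i k); field; rewrite gt_eqF.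
  - apply/negP => bs; apply: xE => /=; apply/flatten_mapP; exists k.
      by rewrite mem_iota k1 add1n ltnW.
    rewrite mem_cat; apply/orP; right; apply/mapP; eexists; first exact: bs.
    by rewrite -/(q i k); field; rewrite gt_eqF.
have muA i : lebesgue_measure (A i) = (L%:R^-1)%:E.
  have mE : measurable [set` E i] by exact: measurable_seq.
  have mc : measurable (cell i) by exact: measurable_itv.
  have : lebesgue_measure (cell i) = (L%:R^-1)%:E.
    rewrite lebesgue_measure_itv /= lte_fin ltr_pM2r ?invr_gt0 // ltr_nat ltnSn.
    by rewrite -EFinB -mulrBl -natrB // subSnn mul1r.
  have := measureDI lebesgue_measure mc mE; rewrite -/(A i).
  rewrite [X in (_ + X)%E](_ : _ = 0%E); last first.
    apply: countable_lebesgue_measure0; apply: finite_set_countable.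
    by apply: sub_finite_set (finite_seq (E i)) => x [].
  by rewrite adde0 => <-.
have AI i : (i < L)%N -> A i `<=` @I01 R.
  move=> iL x [/= xc _]; move: xc; rewrite /I01 /= !in_itv /= => /andP[ix xi].
  rewrite (le_lt_trans _ ix) ?divr_ge0 //=; apply: lt_le_trans xi _.
  by rewrite ler_pdivrMr // mul1r ler_nat.
have mI : measurable (@I01 R) by exact: measurable_itv.
have := @integral_le_nonneg _ _ R lebesgue_measure (@I01 R)
  (fun x => \sum_(0 <= i < L) ((Q i ^+ 2)%:E * (\1_(A i) x)%:E)%E) (fun x => (F x ^+ 2)%:E).
move=> /(_ _ _)/le_lt_trans/(_ Ha) main.
rewrite -lte_fin; apply: le_lt_trans (main _ _).
- rewrite ge0_integral_sum //; last 2 first.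
  + move=> i; apply: measurable_funeM; apply/measurable_realfun.measurable_EFinP.
    by apply: measurable_realfun.measurable_indic; exact: mA.
  + by move=> i x _; rewrite mule_ge0 // lee_fin // sqr_ge0.
  rewrite -sumEFin big_nat [X in (_ <= X)%E]big_nat; apply: lee_sum => i /andP[_ iL].
  rewrite ge0_integralZl_EFin ?sqr_ge0 //; last first.
  + apply/measurable_realfun.measurable_EFinP.
    by apply: measurable_realfun.measurable_indic; exact: mA.
  have e := integral_indic lebesgue_measure mI (mA i).
  rewrite (setIidl (AI i iL)) in e; have {}e := etrans e (muA i).
  by rewrite e -EFinM.
- by move=> x; apply: sume_ge0 => i _; rewrite mule_ge0 // lee_fin // sqr_ge0.
move=> x _; have [[i [iL Aix]]|no] := pselect (exists i, (i < L)%N /\ A i x); last first.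
  rewrite big_nat big1 ?lee_fin ?sqr_ge0 // => i /andP[_ iL].
  by rewrite indicE memNset ?mule0 // => Aix; apply: no; exists i.
rewrite big_mkord (bigD1 (Ordinal iL)) //= big1 ?adde0 => [|j ji].
  by rewrite indicE mem_set // mule1 (FQ i x Aix).
rewrite indicE memNset ?mule0 // => -[/= xj _]; case: Aix => /= xi _.
move: xi xj; rewrite /cell /= !in_itv /= !ltr_pdivrMr // !ltr_pdivlMr // => /andP[a1 a2] /andP[a3 a4].
have := lt_trans a1 a4; have := lt_trans a3 a2; rewrite !ltr_nat => b1 b2.
by move/eqP: ji; apply; apply/val_inj => /=; lia.
Qed.
End OddCells.

(** * The jump set *)

(** Take [u = m + n * t] with [t] the part of [N] prime to [m]: a prime dividing [N] divides exactly
    one of [m] and [n * t], hence not [u]. *)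
Lemma coprime_lift (N n m : nat) : (0 < N)%N -> (0 < m)%N -> coprime m n ->
  exists2 u, coprime u N & (u = m %[mod n])%N.
Proof.
move=> N0 m0 mn; pose t := (N`_(\pi(m)^'))%N.
exists (m + n * t)%N; last by rewrite addnC mulnC modnMDl.
rewrite /coprime; apply/eqP; have := dvdn_gcdl (m + n * t) N; have := dvdn_gcdr (m + n * t) N.
set d := gcdn _ _ => dN dm; have d0 : (0 < d)%N by rewrite gcdn_gt0 N0 orbT.
apply/eqP; rewrite eqn_leq d0 andbT leqNgt; apply/negP => d1.
have pp := pdiv_prime d1; have pd := pdiv_dvd d; move: (pdiv d) pp pd => p pp pd.
have pN := dvdn_trans pd dN; have pu := dvdn_trans pd dm.
have [pm|pm] := boolP (p %| m)%N.
  move: pu; rewrite dvdn_addr // Euclid_dvdM // => /orP[pn|pt].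
    have : (p %| gcdn m n)%N by rewrite dvdn_gcd pm pn.
    by rewrite (eqP mn) dvdn1 => /eqP p1; rewrite p1 in pp.
  have tp : (\pi(m)^')%N.-nat t := part_pnat _ _.
  have /pnatP-/(_ (part_gt0 _ _) p pp pt) := tp.
  by rewrite inE /= mem_primes pp m0 pm.
have ppi : (\pi(m)^')%N.-nat p by rewrite pnatE // inE /= mem_primes pp m0 (negPf pm).
have pt : (p %| t)%N by rewrite -[p in (p %| _)%N](part_pnat_id ppi) partn_dvd.
by move: pu; rewrite dvdn_addl ?dvdn_mull // (negPf pm).
Qed.

(** The reflection [m |-> n - m] exchanges the two halves of the units, and [2 m = n] is impossible
    for a unit when [n > 2]. *)
Lemma totient_double_half (n : nat) : (2 < n)%N ->
  (2 * size [seq m <- iota 1 n.-1 | coprime m n && (2 * m < n)])%N = totient n.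
Proof.
move=> n2; have n0 : (0 < n)%N by lia.
have -> : size [seq m <- iota 1 n.-1 | coprime m n && (2 * m < n)]%N =
   (\sum_(1 <= m < n) (coprime m n && (2 * m < n)))%N.
  by rewrite size_filter -sum1_count /index_iota subn1 big_mkcond.
have e0 : coprime n 0 = false by rewrite /coprime gcdn0 gtn_eqF //; lia.
rewrite totient_count_coprime [RHS]big_ltn // e0 add0n.
have rev : (\sum_(1 <= m < n) (coprime m n && (2 * m < n)) =
    \sum_(1 <= m < n) (coprime m n && (n < 2 * m)))%N.
  rewrite big_nat_rev /= !big_nat; apply: eq_bigr => m /andP[m1 mn].
  have -> : (1 + n - m.+1 = n - m)%N by lia.
  have -> : coprime (n - m) n = coprime m n.
    have aux k : coprime k (k + m) = coprime m (k + m) by rewrite /coprime gcdnDl gcdnDr gcdnC.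
    by have := aux (n - m)%N; rewrite subnK // ltnW.
  by congr (nat_of_bool (_ && _)); lia.
rewrite mul2n -addnn {2}rev -big_split /= !big_nat; apply: eq_bigr => m /andP[m1 mn].
rewrite [coprime n m]coprime_sym; case mc: (coprime m n) => //=.
have [||e] := ltngtP (2 * m)%N n => //.
by move: mc; rewrite /coprime -e mulnC gcdnMr => /eqP m1'; lia.
Qed.

Section JumpOrbits.
Variables (R : realType) (phi : R -> R).
Hypotheses (phi_step : inSr phi) (phi_cyclic : inC phi).

(** On a grid refining [1/h0] the jumps are [g], and [g m = e * g (u * m)] with [e] nonzero for
    every unit [u] mod [2 h]. *)
Lemma jump_grid : exists h0, [/\ (0 < h0)%N,
  forall x, 0 < x < 1 -> jump phi x != 0 -> exists m, (0 < m < h0)%N /\ x = m%:R / h0%:R &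
  forall h u m m', (0 < h)%N -> (h0 %| h)%N -> coprime u (2 * h) -> (0 < m < h)%N -> (0 < m' < h)%N ->
    (m' = u * m %[mod 2 * h])%N -> (jump phi (m%:R / h%:R) != 0) = (jump phi (m'%:R / h%:R) != 0)].
Proof.
have [h0 [s [h00 Hs]]] := step_cell_values phi_step.
exists h0; split=> // [x x01 jx|h u m m' hp hh uN mh mh' E].
  have [v Hv] := Hs h0 h00 (dvdnn h0).
  exact: cell_values_jump_grid h00 Hv x01 jx.
have [v Hv] := Hs h hp hh.
pose V := odd_cells h v; pose N := (2 * h)%N.
have N0 : (0 < N)%N by rewrite muln_gt0.
have Vodd i j : (N %| (i + j).+1)%N -> V j = - V i by apply: odd_cells_odd.
have zf := cyclic_zero_free hp Vodd (cyclic_cells hp Hv phi_cyclic).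
pose g i := V i - V (i + N).-1.
have gN : mod_periodic N g := cell_jumps_periodic hp Vodd.
have [e e0 ce] := zero_free_sign N0 (cos_transform_periodic g N0) zf uN.
have gu := cos_transform_semicharacter N0 gN (cell_jumps_even hp Vodd) uN ce.
have jg i : (0 < i < h)%N -> jump phi (i%:R / h%:R) = g i.
  move=> ih; rewrite (cell_values_jump ih Hv) /g; move: ih => /andP[i0 ih].
  have Vv k : (k < h)%N -> V k = v k.
    by move=> kh; rewrite /V /odd_cells modn_small ?kh //; lia.
  have -> : V (i + N).-1 = V i.-1.
    by apply: (odd_cells_periodic hp Vodd); rewrite -{1}(prednK i0) addSn /= modnDr.
  by rewrite !Vv // (leq_ltn_trans (leq_pred i)).
by rewrite !jg // (gN _ _ E) (gu m) mulf_eq0 (negPf e0).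
Qed.

(** On the grid of step [1 / (h0 n)] the two points have indices [2 h0] and [2 h0 m]; modulo
    [2 h0 n] the second is [u] times the first as soon as [u] is congruent to [m] mod [n]. *)
Lemma jump_block n m : (2 < n)%N -> (0 < m)%N -> (2 * m < n)%N -> coprime m n ->
  (jump phi (2 / n%:R) != 0) = (jump phi ((2 * m)%:R / n%:R) != 0).
Proof.
move=> n2 m0 mn mcn; have [h0 [h00 _ Hh]] := jump_grid.
have n0 : (0 < n)%N by lia.
have N0 : (0 < 2 * (h0 * n))%N by rewrite !muln_gt0 h00 n0.
have [u uN um] := coprime_lift N0 m0 mcn.
have nn0 : n%:R != 0 :> R by rewrite pnatr_eq0 -lt0n.
have hn0 : h0%:R != 0 :> R by rewrite pnatr_eq0 -lt0n.
have -> : 2 / n%:R = (2 * h0)%:R / (h0 * n)%:R :> R by rewrite !natrM; field; rewrite nn0 hn0.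
have -> : (2 * m)%:R / n%:R = (2 * m * h0)%:R / (h0 * n)%:R :> R.
  by rewrite !natrM; field; rewrite nn0 hn0.
apply: (Hh _ u); rewrite ?muln_gt0 ?h00 ?n0 ?m0 ?dvdn_mulr //=.
- by rewrite [(h0 * n)%N]mulnC ltn_pmul2r.
- by rewrite [(h0 * n)%N]mulnC ltn_pmul2r.
have -> : (2 * (h0 * n) = 2 * h0 * n)%N by rewrite mulnA.
have -> : (2 * m * h0 = 2 * h0 * m)%N by rewrite mulnAC.
by rewrite [(u * _)%N]mulnC -!muln_modr um.
Qed.
End JumpOrbits.

Theorem theorem1p7 (R : realType) (phi : R -> R) :
  inSr phi -> inC phi ->
  (* jumps = union of the blocks over the index set ... *)
  jumps phi = \bigcup_(n in [set n | idx phi n]) @block R n /\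
  (* ... and the union is disjoint *)
  (forall n n', idx phi n -> idx phi n' -> n <> n' ->
     @block R n `&` @block R n' = set0) /\
  (* N = number of jumps, 2N = sum over the (finite) index set of totient *)
  exists (r : seq R) (s : seq nat),
    [/\ uniq r, (forall x, x \in r <-> jumps phi x),
        uniq s, (forall n, n \in s <-> idx phi n) &
        (2 * size r)%N = (\sum_(n <- s) totient n)%N].
Proof.
move=> stp cyc; have [h0 [h00 grid _]] := jump_grid stp cyc.
have block_jump := jump_block stp cyc.
have I01E z : (z \in @I01 R) = (0 < z < 1) by apply/idP/idP; rewrite inE /I01 /= in_itv.
have frac_lt1 n m : (0 < m)%N -> (m < n)%N -> 0 < (m%:R / n%:R : R) < 1.
  move=> m0 mn; have n0 : 0 < n%:R :> R by rewrite ltr0n; lia.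
  apply/andP; split; first by rewrite divr_gt0 // ltr0n.
  by rewrite ltr_pdivrMr // mul1r ltr_nat.
have jumpsE : jumps phi = \bigcup_(n in [set n | idx phi n]) @block R n.
  apply/seteqP; split=> x.
    case; rewrite I01E => x01 jx; have [M [/andP[M0 Mh] xE]] := grid x x01 jx.
    (* Reducing [M / (2 h0)], rather than [M / h0], to lowest terms [m / n] gives [x = 2 m / n]. *)
    pose d := gcdn M (2 * h0); have d0 : (0 < d)%N by rewrite gcdn_gt0 M0.
    pose m := (M %/ d)%N; pose n := (2 * h0 %/ d)%N.
    have mE : M = (m * d)%N by rewrite divnK // dvdn_gcdl.
    have nE : (2 * h0 = n * d)%N by rewrite divnK // dvdn_gcdr.
    have mn : coprime m n.
      by rewrite /coprime -(eqn_pmul2r d0) mul1n muln_gcdl -mE -nE.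
    have m0 : (0 < m)%N by move: M0; rewrite mE muln_gt0 => /andP[].
    have m2n : (2 * m < n)%N.
      by rewrite -(ltn_pmul2r d0) -nE -mulnA -mE; lia.
    have xmn : x = (2 * m)%:R / n%:R.
      have h0n : h0%:R != 0 :> R by rewrite pnatr_eq0 -lt0n.
      have nn0 : n%:R != 0 :> R by rewrite pnatr_eq0; lia.
      have dn0 : d%:R != 0 :> R by rewrite pnatr_eq0 -lt0n.
      have h0E : h0%:R = n%:R * d%:R / 2 :> R.
        by rewrite -natrM -nE natrM; field.
      by rewrite xE mE h0E !natrM; field; rewrite nn0 dn0.
    exists n; last by exists m.
    by split; [lia|rewrite (block_jump n m) -?xmn //; lia].
  move=> [n [n3 jn] [m [m1 m2 mn ->]]]; split; first by rewrite I01E frac_lt1 //; lia.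
  by rewrite -block_jump.
have block_inj n n' m m' : (0 < n)%N -> (0 < n')%N -> coprime m n -> coprime m' n' ->
    (2 * m)%:R / n%:R = (2 * m')%:R / n'%:R :> R -> n = n'.
  move=> n0 n0' mn mn' /eqP; rewrite eqr_div ?pnatr_eq0 -?lt0n // -!natrM eqr_nat -!mulnA.
  rewrite eqn_pmul2l // => /eqP e.
  have d1 : (n %| n')%N by rewrite -(Gauss_dvdr _ (_ : coprime n m)) 1?coprime_sym // e dvdn_mull.
  have d2 : (n' %| n)%N by rewrite -(Gauss_dvdr _ (_ : coprime n' m')) 1?coprime_sym // -e dvdn_mull.
  by apply/eqP; rewrite eqn_dvd d1 d2.
split=> //; split.
  move=> n n' [n3 _] [n3' _] nn'; rewrite -subset0 => x [[m [_ _ mn ->]] [m' [_ _ mn' e]]].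
  by apply: nn'; apply: block_inj mn mn' e; lia.
(* A jump at [2 / n] lies on the grid of step [1 / h0], so [n] divides [2 h0]; this bounds the index
   set. *)
pose s := [seq n <- iota 3 (2 * h0) | jump phi (2 / n%:R) != 0].
pose B n := [seq m <- iota 1 n.-1 | coprime m n && (2 * m < n)%N].
pose r := [seq (2 * m)%:R / n%:R : R | n <- s, m <- B n].
have sE n : n \in s <-> idx phi n.
  rewrite mem_filter mem_iota; split=> [/and3P[jn n3 _]|[n3 jn]]; first by split.
  rewrite jn n3 /=; have [//|M [/andP[M0 Mh] e]] := grid (2 / n%:R) _ jn.
    by apply: (frac_lt1 n 2); lia.
  have n0 : n%:R != 0 :> R by rewrite pnatr_eq0; lia.
  have h0n : h0%:R != 0 :> R by rewrite pnatr_eq0 -lt0n.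
  move/eqP: e; rewrite eqr_div // -!natrM eqr_nat => /eqP e.
  by have : (n <= 2 * h0)%N; [rewrite e leq_pmull|lia].
have BE n m : m \in B n <-> [/\ (1 <= m)%N, (2 * m < n)%N & coprime m n].
  rewrite mem_filter mem_iota; split=> [/andP[/andP[-> ->] /andP[-> _]] //|[-> m2 ->]].
  by rewrite m2 /=; lia.
exists r, s; split=> //.
- apply: allpairs_uniq_dep => [|n _|]; rewrite ?filter_uniq ?iota_uniq //.
  move=> [n m] [n' m'] /allpairsPdep[a [b [/sE[a3 _] /BE[_ _ ab] [? ?]]]].
  move=> /allpairsPdep[a' [b' [/sE[a3' _] /BE[_ _ ab'] [? ?]]]] /=; subst.
  move=> e; have nn : a = a' by apply: block_inj ab ab' e; lia.
  subst; congr Tagged; move: e => /(mulIf _); rewrite invr_eq0 pnatr_eq0 -lt0n => /(_ _)/eqP.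
  by rewrite eqr_nat eqn_pmul2l // => H; apply/eqP/H; lia.
- move=> x; rewrite jumpsE; split.
    move=> /allpairsPdep[n [m [/sE ns /BE[m1 m2 mn] ->]]].
    by exists n => //; exists m.
  move=> [n ns [m [m1 m2 mn ->]]]; apply: allpairs_f_dep; first exact/sE.
  exact/BE.
- by rewrite filter_uniq ?iota_uniq.
rewrite size_allpairs_dep sumnE big_map big_distrr /= big_seq [RHS]big_seq.
by apply: eq_bigr => n /sE[n3 _]; apply: totient_double_half.
Qed.
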